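(* Let $(A,G,\alpha)$ be a $C^*$-dynamical system with $G$ a locally compact abelian group. Let $a$ and $b$ be $\alpha$-integrable elements of $A$ such that $a\stackrel{rc}{\sim}b$. Then, for each $g\in C_c(G)$ one has that $a'\stackrel{rc}{\sim}b$, where $a'=\int_Gg(t)\alpha_t(a)\,dt$.
   Context: $\alpha$ is a strongly continuous action of $G$ (with fixed Haar measure $dt$ and Pontryagin dual $\widehat G$) on the $C^*$-algebra $A$. Integrability: a function $f:G\to A$ is unconditionally integrable if it is Bochner integrable over every relatively compact (measurable) $K\subseteq G$ and the net $\{\int_K f(t)\,dt\}_K$, indexed by the relatively compact subsets ordered by inclusion, converges in norm; the limit is denoted $\int^u_G f(t)\,dt$. An element $a\in A$ is $\alpha$-integrable if for every $b\in A$ the functions $t\mapsto \alpha_t(a)b$ and $t\mapsto b\,\alpha_t(a)$ are unconditionally integrable. (It is a fact that the element $a'$ of the statement is $\alpha$-integrable.) Fourier coefficients: write $\langle x,t\rangle$ for the duality between $x\in\widehat G$ and $t\in G$. For $a$ $\alpha$-integrable and $x\in\widehat G$, $E_x(a)$ is the element of the multiplier algebra $M(A)$ determined by $E_x(a)b=\int^u_G\langle x,t\rangle\alpha_t(a)b\,dt$ and $bE_x(a)=\int^u_G\langle x,t\rangle b\,\alpha_t(a)\,dt$ for $b\in A$. Relative continuity: for $\alpha$-integrable $a,b$ write $a\stackrel{rc}{\sim}b$ if $\|E_{xz}(a)E_y(b)-E_x(a)E_{zy}(b)\|\to0$ as $z\to e$ in $\widehat G$, uniformly in $x,y\in\widehat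 G$. *)

(* Defs.v *)
(* Scalars are the complex numbers R[i] over R : realType;
   R[i] carries its topology under the alias R[i]^o. *)
From HB Require Import structures.
From mathcomp Require Import all_boot all_order all_algebra.
From mathcomp Require Import all_classical all_reals all_analysis.
From mathcomp Require Import complex.

Set Implicit Arguments.
Unset Strict Implicit.
Unset Printing Implicit Defensive.

Import Order.TTheory GRing.Theory Num.Theory.
Import numFieldNormedType.Exports.

Local Open Scope classical_set_scope.
Local Open Scope complex_scope.
Local Open Scope ring_scope.

Reserved Notation "a ** b" (at level 40, left associativity).

(* The norm of a complex normed space takes values in R[i]; [rnorm] is the same
   nonnegative number seen in R. *)
Definition rnorm (R : realType) (V : normedModType R[i]) (v : V) : R :=
  complex.Re `|v|.

(* The multiplication is not required to have a unit. *)
HB.mixin Record isCStarAlgebra (R : realType) A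
    of CompleteNormedModule R[i] A := {
  cmul : A -> A -> A;
  cstar : A -> A;
  cmulA : associative cmul;
  cmulDl : left_distributive cmul +%R;
  cmulDr : right_distributive cmul +%R;
  cmulZl : forall (k : R[i]) (a b : A), cmul (k *: a) b = k *: cmul a b;
  cmulZr : forall (k : R[i]) (a b : A), cmul a (k *: b) = k *: cmul a b;
  cmul_norm : forall a b : A, `|cmul a b| <= `|a| * `|b|;
  cstarK : involutive cstar;
  cstarD : {morph cstar : a b / a + b};
  cstarZ : forall (k : R[i]) (a : A), cstar (k *: a) = k^*%C *: cstar a;
  cstarM : forall a b : A, cstar (cmul a b) = cmul (cstar b) (cstar a);
  cstar_norm : forall a : A, `|cmul (cstar a) a| = `|a| ^+ 2
}.

#[short(type="cstarAlgType")]
HB.structure Definition CStarAlgebra (R : realType) :=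
  { A of CompleteNormedModule R[i] A & isCStarAlgebra R A }.

Notation "a ** b" := (cmul a b) : ring_scope.

(* M(A) as the algebra of double centralizers: m acts on A by
   m b = lmult m b and b m = rmult m b. *)
Section Multiplier.
Context {R : realType} {A : cstarAlgType R}.

Record multiplier : Type := Multiplier {
  lmult : {linear A -> A};
  rmult : {linear A -> A};
  lmult_continuous : continuous lmult;
  rmult_continuous : continuous rmult;
  multP : forall a b : A, a ** lmult b = rmult a ** b
}.

HB.instance Definition _ := gen_eqMixin multiplier.
HB.instance Definition _ := gen_choiceMixin multiplier.

Lemma cmul0r (a : A) : 0 ** a = 0.
Proof. by rewrite -(scale0r (0 : A)) cmulZl !scale0r. Qed.

Lemma cmulr0 (a : A) : a ** 0 = 0.
Proof. by rewrite -(scale0r (0 : A)) cmulZr !scale0r. Qed.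

Lemma cmulBl (a b c : A) : (a - b) ** c = a ** c - b ** c.
Proof. by rewrite cmulDl -(scaleN1r b) cmulZl scaleN1r. Qed.

Lemma cmulBr (a b c : A) : a ** (b - c) = a ** b - a ** c.
Proof. by rewrite cmulDr -(scaleN1r c) cmulZr scaleN1r. Qed.

Definition mult0 : multiplier.
Proof.
refine (@Multiplier (\0 : {linear A -> A}) (\0 : {linear A -> A}) _ _ _).
- by move=> x; exact: cvg_cst.
- by move=> x; exact: cvg_cst.
- by move=> a b /=; rewrite cmul0r cmulr0.
Defined.

Definition mult_mul (m n : multiplier) : multiplier.
Proof.
refine (@Multiplier (lmult m \o lmult n : {linear A -> A})
                    (rmult n \o rmult m : {linear A -> A}) _ _ _).
- by move=> x; apply: continuous_comp; exact: lmult_continuous.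
- by move=> x; apply: continuous_comp; exact: rmult_continuous.
- by move=> a b /=; rewrite !multP.
Defined.

Definition mult_sub (m n : multiplier) : multiplier.
Proof.
refine (@Multiplier (lmult m \- lmult n : {linear A -> A})
                    (rmult m \- rmult n : {linear A -> A}) _ _ _).
- by move=> x; apply: cvgB; exact: lmult_continuous.
- by move=> x; apply: cvgB; exact: rmult_continuous.
- by move=> a b /=; rewrite cmulBr cmulBl !multP.
Defined.

Definition mult_norm (m : multiplier) : R :=
  sup [set rnorm (lmult m b) | b in [set b : A | `|b| <= 1]].

End Multiplier.
Arguments multiplier {R} A.

(* Pontryagin dual: continuous homomorphisms G -> {|z| = 1} under pointwise
   multiplication, with the compact-open topology. *)
Section Dual.
Context {R : realType} {G : topologicalZmodType}.

Record dual : Type := Character {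
  character :> G -> R[i];
  character_norm : forall t, `|character t| = 1;
  characterD : forall s t, character (s + t) = character s * character t;
  character_continuous : continuous (character : G -> R[i]^o)
}.

Lemma dual_ext (x y : dual) : (forall t, x t = y t) -> x = y.
Proof.
case: x y => [x x1 xD xc] [y y1 yD yc] /= /funext xy; subst y.
by congr Character; exact: Prop_irrelevance.
Qed.

Lemma character_neq0 (x : dual) t : x t != 0.
Proof. by rewrite -normr_eq0 character_norm oner_eq0. Qed.

Definition dual_one : dual.
Proof.
refine (@Character (fun=> 1) _ _ _).
- by move=> t; rewrite normr1.
- by move=> s t; rewrite mulr1.
- by move=> t; exact: cvg_cst.
Defined.

Definition dual_mul (x y : dual) : dual.
Proof.
refine (@Character (fun t => x t * y t) _ _ _).
- by move=> t; rewrite normrM !character_norm mulr1.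
- by move=> s t; rewrite !characterD mulrACA.
- move=> t; apply: (@cvgM R[i] G (nbhs t) _ x y);
  exact: character_continuous.
Defined.

Definition dual_inv (x : dual) : dual.
Proof.
refine (@Character (fun t => (x t)^-1) _ _ _).
- by move=> t; rewrite normfV character_norm invr1.
- by move=> s t; rewrite characterD invfM.
- move=> t; apply: (@cvgV R[i] G (nbhs t) _ x); first exact: character_neq0.
  exact: character_continuous.
Defined.

Lemma dual_mulA : associative dual_mul.
Proof. by move=> x y z; apply: dual_ext => t /=; rewrite mulrA. Qed.

Lemma dual_mul1 : left_id dual_one dual_mul.
Proof. by move=> x; apply: dual_ext => t /=; rewrite mul1r. Qed.

Lemma dual_mulr1 : right_id dual_one dual_mul.
Proof. by move=> x; apply: dual_ext => t /=; rewrite mulr1. Qed.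

Lemma dual_mulV : left_inverse dual_one dual_inv dual_mul.
Proof.
by move=> x; apply: dual_ext => t /=; rewrite mulVf// character_neq0.
Qed.

Lemma dual_mulrV : right_inverse dual_one dual_inv dual_mul.
Proof.
by move=> x; apply: dual_ext => t /=; rewrite mulfV// character_neq0.
Qed.

HB.instance Definition _ := gen_eqMixin dual.
HB.instance Definition _ := gen_choiceMixin dual.
HB.instance Definition _ := isGroup.Build dual
  dual_mulA dual_mul1 dual_mulr1 dual_mulV dual_mulrV.

Definition dual_fun (x : dual) : {compact-open, G -> R[i]^o} := character x.

HB.instance Definition _ :=
  Topological.copy dual (initial_topology dual_fun).

End Dual.
Arguments dual R G : clear implicits.

(* The measurable types of the library are pointed; G is pointed by 0. *)
Definition pointed_group (G : topologicalZmodType) : Type := G.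
HB.instance Definition _ (G : topologicalZmodType) :=
  Choice.on (pointed_group G).
HB.instance Definition _ (G : topologicalZmodType) :=
  isPointed.Build (pointed_group G) (0 : G).

Notation borel G :=
  (g_sigma_algebraType (@open G : set (set (pointed_group G)))).

Section Haar.
Context {R : realType} {G : topologicalZmodType}.
Variable mu : {measure set (borel G) -> \bar R}.

Record haar_measure : Prop := HaarMeasure {
  haar_invariant : forall (t : G) (E : set (borel G)), measurable E ->
    mu [set (t + s : G) | s in E] = mu E;
  haar_compact : forall K : set G, compact K -> (mu K < +oo)%E;
  haar_outer_regular : forall E : set (borel G), measurable E ->
    mu E = ereal_inf [set mu U | U in [set U : set G | open U /\ E `<=` U]];
  haar_inner_regular : forall U : set G, open U ->
    mu U = ereal_sup [set mu K | K in [set K : set G | compact K /\ K `<=` U]];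
  haar_neq0 : mu [set: G] != 0%E
}.

End Haar.

Section Bochner.
Context {R : realType} {G : topologicalZmodType}.
Context {V : completeNormedModType R[i]}.
Variable mu : {measure set (borel G) -> \bar R}.
Implicit Types (D K : set (borel G)) (f s : G -> V) (v : V).

Definition integrable_simple D s : Prop :=
  [/\ finite_set (s @` D),
      forall v, measurable (D `&` s @^-1` [set v]) &
      forall v, v != 0 -> (mu (D `&` s @^-1` [set v]) < +oo)%E].

Definition simple_integral D s : V :=
  \sum_(v \in s @` D) ((fine (mu (D `&` s @^-1` [set v])))%:C *: v).

Definition bochner_approx D f (s : nat -> G -> V) : Prop :=
  [/\ forall n, integrable_simple D (s n),
      {ae mu, forall t, D t -> s ^~ t @ \oo --> f t} &
      (\int[mu]_(t in D) (rnorm (f t - s n t))%:E)%E @[n --> \oo] --> 0%E].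

Definition bochner_integrable D f : Prop := exists s : nat -> G -> V, bochner_approx D f s.

Definition is_bochner_integral D f v : Prop :=
  exists2 s : nat -> G -> V, bochner_approx D f s & simple_integral D (s n) @[n --> \oo] --> v.

(* Equal to 0 when f is not Bochner integrable over D. *)
Definition bochner_integral D f : V := xget 0 (is_bochner_integral D f).

Definition relatively_compact : set (set (borel G)) :=
  [set K : set (borel G) | @precompact G K /\ measurable K].

(* The filter of the net of relatively compact sets ordered by inclusion. *)
Definition relcompact_net : set_system (set (borel G)) :=
  filter_from relatively_compact
    (fun K0 => [set K | relatively_compact K /\ K0 `<=` K]).

Definition is_uncond_integral f v : Prop :=
  (forall K, relatively_compact K -> bochner_integrable K f) /\
  bochner_integral K f @[K --> relcompact_net] --> v.

Definition uncond_integrable f : Prop := exists v, is_uncond_integral f v.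

End Bochner.

Section DynamicalSystem.
Context {R : realType} {G : topologicalZmodType} {A : cstarAlgType R}.

Record strongly_continuous_action : Type := StronglyContinuousAction {
  act :> G -> A -> A;
  act_linear : forall t, linear (act t);
  act_mul : forall t, {morph act t : a b / a ** b};
  act_star : forall t, {morph act t : a / cstar a};
  act0 : forall a, act 0 a = a;
  actD : forall s t a, act (s + t) a = act s (act t a);
  act_continuous : forall a, continuous (act ^~ a)
}.

Variables (mu : {measure set (borel G) -> \bar R}).
Variables (alpha : strongly_continuous_action).

Definition act_integrable (a : A) : Prop := forall b : A,
  uncond_integrable mu (fun t => alpha t a ** b) /\
  uncond_integrable mu (fun t => b ** alpha t a).

Definition is_fourier_coeff (x : dual R G) (a : A) (m : multiplier A) : Prop :=
  forall b : A,
    is_uncond_integral mu (fun t => x t *: (alpha t a ** b)) (lmult m b) /\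
    is_uncond_integral mu (fun t => x t *: (b ** alpha t a)) (rmult m b).

(* E_x(a), meaningful for integrable a, where the multiplier exists and is
   unique. *)
Definition fourier_coeff (x : dual R G) (a : A) : multiplier A :=
  xget mult0 (is_fourier_coeff x a).

(* The relation is only defined between integrable elements, so integrability
   of both sides is part of it. *)
Definition rel_continuous (a b : A) : Prop :=
  [/\ act_integrable a, act_integrable b &
      forall eps : R, 0 < eps ->
        \forall z \near (1%g : dual R G), forall x y : dual R G,
          mult_norm (mult_sub
            (mult_mul (fourier_coeff (x * z)%g a) (fourier_coeff y b))
            (mult_mul (fourier_coeff x a) (fourier_coeff (z * y)%g b))) < eps].

End DynamicalSystem.
Arguments strongly_continuous_action {R} G A.

(* g belongs to C_c(G). *)
Definition cont_compact_support (R : realType) (G : topologicalZmodType)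
    (g : G -> R[i]) : Prop :=
  continuous (g : G -> R[i]^o) /\ compact (closure [set t | g t != 0]).

(* Main.v *)
Require Import Defs.
From HB Require Import structures.
From mathcomp Require Import all_boot all_order all_algebra finmap.
From mathcomp Require Import all_classical all_reals all_analysis.
From mathcomp Require Import measurable_realfun.
From mathcomp Require Import complex ring lra.

(* All integrands in sight are continuous, so their Bochner integrals over a
   relatively compact set are limits of Riemann sums over finite measurable
   partitions; linearity, additivity, translation and exchange with a bounded
   operator are read off these sums.  Unconditional convergence amounts to
   smallness of the integrals over the sets disjoint from a large one, a
   condition that survives multiplication of the integrand by a character.  By
   uniform boundedness the Fourier coefficients [E_x(a)] then exist and satisfy
   [sup_x ||E_x(a)|| < oo].

   Applying the bounded operator [c |-> int_K <x,t> alpha_t(c) b dt] to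
   [a' = int g(s) alpha_s(a) ds] and letting [K] grow, uniformly in [s] in the
   support [S] of [g], gives [E_x(a') b = int_S g(s) <x,-s> E_x(a) b ds].  Hence
     E_xz(a') E_y(b) - E_x(a') E_zy(b)
       = int_S g(s) <x,-s> ((<z,-s> - 1) E_xz(a) E_y(b)
           + (E_xz(a) E_y(b) - E_x(a) E_zy(b))) ds,
   where [<z,-s> - 1] tends to [0] uniformly on the compact set [S] as [z]
   tends to [1]. *)

Set Implicit Arguments.
Unset Strict Implicit.
Unset Printing Implicit Defensive.

Import Order.TTheory GRing.Theory Num.Theory.
Import numFieldNormedType.Exports.

Local Open Scope classical_set_scope.
Local Open Scope ring_scope.
Local Open Scope complex_scope.

(** [strongly_continuous_action] puts no norm condition on [act t], yet the integral over [K] has to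
    be a bounded operator in the element integrated. A bound is extracted from the algebra alone: a
    self-adjoint [h] of norm at most 1/2 is completed to a unitary by relations that every
    star-morphism preserves, and unitaries act isometrically.

    A character cannot be handled through the norm of the integrand, since unconditional
    integrability is not absolute integrability. Instead, a sum with coefficients in the unit disc
    is at most four times its largest subsum; this is why smallness is required on all sets disjoint
    from a large one, a family closed under measurable subsets.

    [fourier_coeff] and [bochner_integral] are choices with a default value, and the supremum in
    [mult_norm] is 0 on an unbounded set. Existence and boundedness of the coefficients must
    therefore come before any estimate drawn from [mult_norm]. *)

Section RealNorm.
Context {R : realType} {V : normedModType R[i]}.
Implicit Types (u v w : V) (k : R[i]).

Lemma normE v : `|v| = (rnorm v)%:C.
Proof. by rewrite /rnorm RRe_real// ger0_real. Qed.

Lemma rnorm_ge0 v : 0 <= rnorm v.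
Proof. by rewrite -lecR -normE normr_ge0. Qed.

Lemma rnormD u v : rnorm (u + v) <= rnorm u + rnorm v.
Proof. by rewrite -lecR rmorphD/= -!normE ler_normD. Qed.

Lemma rnormN v : rnorm (- v) = rnorm v.
Proof. by rewrite /rnorm normrN. Qed.

Lemma rnorm_distC u v : rnorm (u - v) = rnorm (v - u).
Proof. by rewrite /rnorm distrC. Qed.

Lemma rnorm_distD w u v : rnorm (u - v) <= rnorm (u - w) + rnorm (w - v).
Proof. by have := rnormD (u - w) (w - v); rewrite addrA subrK. Qed.

Lemma rnormB u v : rnorm (u - v) <= rnorm u + rnorm v.
Proof. by rewrite -(rnormN v) rnormD. Qed.

Lemma rnorm0 : rnorm (0 : V) = 0.
Proof. by rewrite /rnorm normr0. Qed.

Lemma rnorm_le0 v : rnorm v <= 0 -> v = 0.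
Proof.
move=> v0; apply/normr0_eq0; rewrite normE.
by have/eqP -> : rnorm v == 0 by rewrite eq_le v0 rnorm_ge0.
Qed.

Lemma rnormZ k v : rnorm (k *: v) = rnorm (k : R[i]^o) * rnorm v.
Proof.
by apply: complexI; rewrite rmorphM/= -!normE normrZ.
Qed.

Lemma rnormZr (r : R) v : rnorm (r%:C *: v) = `|r| * rnorm v.
Proof. by rewrite rnormZ /rnorm/= expr0n/= addr0 sqrtr_sqr. Qed.

Lemma rnorm_sum (I : Type) (s : seq I) (P : pred I) (F : I -> V) :
  rnorm (\sum_(i <- s | P i) F i) <= \sum_(i <- s | P i) rnorm (F i).
Proof.
elim/big_rec2: _ => [|i x y _ xy]; first by rewrite rnorm0.
by rewrite (le_trans (rnormD _ _))// lerD2l.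
Qed.

(** Two integrals compared through one Riemann sum differ by at most [e] times a fixed constant;
    this turns such estimates into equations. *)
Lemma rnorm_small v (C : R) : (forall e, 0 < e -> rnorm v <= e * C) -> v = 0.
Proof.
move=> vC; apply: rnorm_le0; apply/ler_addgt0Pr => e e0; rewrite add0r.
have C1 : 0 < `|C| + 1 by rewrite ltr_wpDl.
apply: (le_trans (vC (e / (`|C| + 1)) _)); first by rewrite divr_gt0.
rewrite mulrAC ler_pdivrMr// ler_wpM2l ?(ltW e0)//.
by rewrite (le_trans (ler_norm _))// lerDl.
Qed.

Lemma cvg_rnormP (T : Type) (F : set_system T) (FF : Filter F) (f : T -> V) v :
  f @ F --> v <-> forall e : R, 0 < e -> \forall t \near F, rnorm (f t - v) < e.
Proof.
split=> [/cvgrPdist_lt fv e e0|fv].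
  have := fv e%:C; rewrite ltcR => /(_ e0).
  by apply: filterS => t; rewrite normE ltcR rnorm_distC.
apply/cvgrPdist_lt => e e0.
have eE : e = (complex.Re e)%:C by rewrite RRe_real// gtr0_real.
move: e0; rewrite eE ltcR => /fv.
by apply: filterS => t; rewrite normE ltcR rnorm_distC.
Qed.

Lemma nbhs_rnormP v (P : set V) :
  nbhs v P <-> exists2 e : R, 0 < e & forall u, rnorm (u - v) < e -> P u.
Proof.
split=> [/nbhs_normP[e /= e0 eP]|[e e0 eP]].
  have eE : e = (complex.Re e)%:C by rewrite RRe_real// gtr0_real.
  exists (complex.Re e); first by rewrite -ltcR -eE.
  by move=> u uv; apply: eP => /=; rewrite eE normE ltcR rnorm_distC.
apply/nbhs_normP; exists e%:C => /=; first by rewrite ltcR.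
by move=> u /=; rewrite normE ltcR rnorm_distC => /eP.
Qed.

Lemma cvg_rnorm_le (T : Type) (F : set_system T) (FF : ProperFilter F)
    (f : T -> V) v (C : R) :
  f @ F --> v -> (\forall t \near F, rnorm (f t) <= C) -> rnorm v <= C.
Proof.
move=> /cvg_rnormP fv fC; apply/ler_addgt0Pr => e e0.
have [t [tv tC]] := filter_ex (filterI (fv e e0) fC).
rewrite -(subrK (f t) v) (le_trans (rnormD _ _))// addrC lerD//.
by rewrite rnorm_distC ltW.
Qed.

End RealNorm.

(** * Completeness and the uniform boundedness principle *)

Section Complete.
Context {R : realType} {V : completeNormedModType R[i]}.

Lemma cauchy_rnorm_cvg (T : Type) (F : set_system T) (FF : ProperFilter F)
    (f : T -> V) :
  (forall e : R, 0 < e -> exists2 P, F P &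
    forall s t, P s -> P t -> rnorm (f s - f t) < e) ->
  exists v : V, f @ F --> v.
Proof.
move=> fC; exists (lim (f @ F)); apply: (@cauchy_cvg V).
apply: (@cauchy_exP R[i] V) => e e0.
have eE : e = (complex.Re e)%:C by rewrite RRe_real// gtr0_real.
move: e0; rewrite eE ltcR => /fC[P FP Pe].
have [s Ps] := filter_ex FP.
exists (f s); apply: (@filterS _ F _ P) => // t Pt.
by rewrite /= -ball_normE /= normE ltcR Pe.
Qed.

End Complete.

Section UniformBoundedness.
Context {R : realType} {V : completeNormedModType R[i]} {W : normedModType R[i]}.

(* Nested balls: each point of a ball has, in both directions [+-u], room for a
   functional to be large. *)
Lemma uniform_boundedness (F : set (V -> W)) :
  (forall f, F f -> linear f /\ exists M, forall v, rnorm (f v) <= M * rnorm v) ->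
  (forall v, exists M, forall f, F f -> rnorm (f v) <= M) ->
  exists2 M, 0 <= M & forall f, F f -> forall v, rnorm (f v) <= M * rnorm v.
Proof.
move=> FL Fpt; apply: contrapT => nM.
have big C : 0 <= C -> exists2 f, F f & exists v, C * rnorm v < rnorm (f v).
  move=> C0; apply: contrapT => nf; apply: nM; exists C => // f Ff v.
  by rewrite leNgt; apply/negP => fv; apply: nf; exists f => //; exists v.
(* A state [(n, (x, r))] is a ball with the size to be reached: the next ball lies inside it, and
   some member of [F] has norm at least [n] on all of that next ball. *)
have step (q : nat * (V * R)) : exists p : V * R, 0 < q.2.2 ->
    [/\ 0 < p.2, rnorm (p.1 - q.2.1) + p.2 <= q.2.2, p.2 <= q.2.2 / 2 &
      exists2 f, F f & forall y, rnorm (y - p.1) <= p.2 -> q.1%:R <= rnorm (f y)].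
  case: q => n [x r] /=; have [r0|] := ltP 0 r; last by move=> _; exists (x, r).
  have C0 : 0 <= n.+1%:R * 2 / r by rewrite divr_ge0 ?mulr_ge0// ltW.
  have [f Ff [v fv]] := big _ C0; have [lf [M fM]] := FL f Ff.
  pose f' : {linear V -> W} := HB.pack f (GRing.isLinear.Build _ _ _ _ _ lf).
  have f0 : f 0 = 0 := linear0 f'.
  have fB y z : f (y - z) = f y - f z := linearB f' y z.
  have fZ k y : f (k *: y) = k *: f y := linearZZ f' k y.
  have v0 : 0 < rnorm v.
    rewrite lt_neqAle rnorm_ge0 andbT; apply/eqP => v0.
    have /rnorm_le0 v00 : rnorm v <= 0 by rewrite -v0.
    by move: fv; rewrite v00 f0 !rnorm0 mulr0 ltxx.
  pose u := (r / 2 / rnorm v)%:C *: v.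
  have c0 : 0 < r / 2 / rnorm v by rewrite !divr_gt0.
  have uE : rnorm u = r / 2 by rewrite rnormZr gtr0_norm// divfK// gt_eqF.
  have fu : n.+1%:R <= rnorm (f u).
    rewrite fZ rnormZr gtr0_norm//= -ler_pdivrMl//.
    apply: le_trans (ltW fv); rewrite le_eqVlt; apply/orP; left; apply/eqP.
    by rewrite !invf_div; field; rewrite !gt_eqF.
  have [x' xx' fx'] : exists2 x', rnorm (x' - x) = r / 2 &
      n.+1%:R <= rnorm (f x').
    (* If [f (x + u)] and [f (x - u)] were both shorter than [n + 1], their difference [f (u + u)]
       would be shorter than [2 (n + 1)], against [fu]. *)
    have [fp|fp] := leP n.+1%:R (rnorm (f (x + u))).
      by exists (x + u) => //; rewrite addrAC subrr add0r.
    exists (x - u); first by rewrite addrAC subrr add0r rnormN.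
    rewrite leNgt; apply/negP => fm.
    have : rnorm (f (x + u) - f (x - u)) < n.+1%:R * 2.
      by rewrite (le_lt_trans (rnormB _ _))// mulr_natr mulr2n ltrD.
    rewrite -fB opprB addrCA addrAC subrr add0r.
    rewrite (_ : u + u = (2%:R)%:C *: u); last first.
      by rewrite rmorph_nat scaler_nat mulr2n.
    by rewrite fZ rnormZr normr_nat mulrC ltr_pM2r// ltNge fu.
  have M0 : 0 < `|M| + 1 by rewrite ltr_wpDl.
  (* The first bound keeps the new ball inside the old one, [x'] being at distance [r / 2] from [x];
     the second lets [f] vary by at most 1, which lowers the [n + 1] reached at the centre to
     [n]. *)
  exists (x', Num.min (r / 2) (`|M| + 1)^-1) => _ /=; split.
  - by rewrite lt_min invr_gt0 M0 divr_gt0.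
  - by rewrite xx' [leRHS]splitr lerD2l ge_min lexx.
  - by rewrite ge_min lexx.
  exists f => // y; rewrite le_min => /andP[_ yx'].
  have fy : rnorm (f (y - x')) <= 1.
    rewrite (le_trans (fM _))// (@le_trans _ _ ((`|M| + 1) * rnorm (y - x')))//.
      by rewrite ler_wpM2r ?rnorm_ge0// (le_trans (ler_norm _))// lerDl.
    by rewrite -ler_pdivlMl// mulr1.
  have : n.+1%:R <= rnorm (f y) + 1.
    rewrite (le_trans fx')// -[in leLHS](subKr y x') fB.
    by rewrite (le_trans (rnormB _ _))// lerD2l.
  by rewrite -[n.+1]addn1 natrD lerD2r.
have [nxt nxtP] := choice step.
pose p := fix p n := if n is m.+1 then nxt (m, p m) else (0 : V, 1 : R).
have r0 n : 0 < (p n).2.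
  by elim: n => [|n ih] //=; have [] := nxtP (n, p n) ih.
have rS n : (p n.+1).2 <= (p n).2 / 2 by have [] := nxtP (n, p n) (r0 n).
have pS n : rnorm ((p n.+1).1 - (p n).1) + (p n.+1).2 <= (p n).2.
  by have [] := nxtP (n, p n) (r0 n).
have pB n m : rnorm ((p (n + m)%N).1 - (p n).1) + (p (n + m)%N).2 <= (p n).2.
  elim: m => [|m ih]; first by rewrite addn0 subrr rnorm0 add0r.
  apply: le_trans ih; rewrite addnS.
  rewrite (le_trans _ (lerD (lexx _) (pS _)))// addrA lerD2r addrC.
  exact: rnorm_distD.
have rn n : (p n).2 <= 2^-1 ^+ n.
  by elim: n => [|n ih] //; rewrite exprSr (le_trans (rS n))// ler_pM2r.
have [x px] : exists x : V, (fun n => (p n).1) @ \oo --> x.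
  apply: cauchy_rnorm_cvg => e e0.
  have : (fun n => 2^-1 ^+ n : R) @ \oo --> (0 : R).
    by apply: cvg_expr; rewrite gtr0_norm// invf_lt1// ltr1n.
  move=> /cvgrPdist_lt/(_ (e / 2)); rewrite divr_gt0// => /(_ erefl)[N _ NP].
  exists [set n | (N <= n)%N]; first by exists N.
  have small : (p N).2 < e / 2.
    rewrite (le_lt_trans (rn N))//.
    by have := NP N (leqnn N); rewrite /= sub0r normrN ger0_norm// exprn_ge0.
  have near n : (N <= n)%N -> rnorm ((p n).1 - (p N).1) < e / 2.
    move=> Nn; rewrite (le_lt_trans _ small)// (le_trans _ (pB N (n - N)%N))//.
    by rewrite subnKC// lerDl ltW.
  move=> m n Nm Nn; rewrite (le_lt_trans (rnorm_distD (p N).1 _ _))//.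
  by rewrite [ltRHS]splitr ltrD ?near// rnorm_distC near.
have xB n : rnorm (x - (p n).1) <= (p n).2.
  apply: (@cvg_rnorm_le _ _ _ \oo _ (fun m => (p m).1 - (p n).1)).
    by apply: cvgB => //; exact: cvg_cst.
  exists n => // m /= nm; have := pB n (m - n)%N; rewrite subnKC//.
  by apply: le_trans; rewrite lerDl ltW.
have [M FM] := Fpt x.
have [n nM'] : exists n : nat, M < n%:R.
  by exists (Num.truncn M).+1; exact: truncnS_gt.
have [_ _ _ [f Ff fn]] := nxtP (n, p n) (r0 n).
by have := le_trans (fn _ (xB n.+1)) (FM _ Ff); rewrite /= leNgt nM'.
Qed.

End UniformBoundedness.

(** * Finite measurable partitions, step functions and simple integrals *)

Section Partition.
Context {R : realType} {G : topologicalZmodType}.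
Variable mu : {measure set (borel G) -> \bar R}.
Implicit Types (S X D : set (borel G)).

Definition is_partition (I : finType) (E : I -> set (borel G)) S :=
  [/\ forall i, measurable (E i), trivIset setT E & \bigcup_i E i = S].

Lemma partition_sub (I : finType) (E : I -> set (borel G)) S i :
  is_partition E S -> E i `<=` S.
Proof. by move=> [_ _ <-] t Et; exists i. Qed.

Lemma partition_measurable (I : finType) (E : I -> set (borel G)) S :
  is_partition E S -> measurable S.
Proof. by move=> [mE _ <-]; apply: fin_bigcup_measurable. Qed.

Lemma partition_setI (I : finType) (E : I -> set (borel G)) S X :
  is_partition E S -> measurable X ->
  is_partition (fun i => E i `&` X) (S `&` X).
Proof.
move=> [mE tE <-] mX; split; first by move=> i; exact: measurableI.
- by apply: trivIset_setIr.
- by rewrite setI_bigcupl.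
Qed.

Lemma partition_prod (I J : finType) (E : I -> set (borel G))
    (F : J -> set (borel G)) S :
  is_partition E S -> is_partition F S ->
  is_partition (fun p => E p.1 `&` F p.2) S.
Proof.
move=> [mE tE ES] [mF tF FS]; split.
- by move=> p; exact: measurableI.
- move=> [i j] [i' j'] _ _ [t [[/= Et Ft] [Et' Ft']]]; congr pair.
  + by apply: tE => //; exists t.
  + by apply: tF => //; exists t.
- apply/seteqP; split=> t.
    by move=> [[i j] _ [/= Et _]]; rewrite -ES; exists i.
  move=> St; move: (St); rewrite -{1}ES => -[i _ Et].
  by move: St; rewrite -FS => -[j _ Ft]; exists (i, j).
Qed.

Lemma partition_unit S : measurable S -> is_partition (fun _ : unit => S) S.
Proof.
move=> mS; split => //; first by move=> [] [].
by apply/seteqP; split=> [t []//|t St]; exists tt.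
Qed.

Lemma partition_sum (I J : finType) (E : I -> set (borel G))
    (F : J -> set (borel G)) S S' :
  is_partition E S -> is_partition F S' -> S `&` S' = set0 ->
  is_partition (fun s => match s with inl i => E i | inr j => F j end)
    (S `|` S').
Proof.
move=> PE PF SS'; have ES := partition_sub PE; have FS := partition_sub PF.
have dis t : S t -> S' t -> False by move=> St S't; rewrite -[False]/(set0 t) -SS'.
move: PE PF => [mE tE ESE] [mF tF FSE]; split.
- by case.
- move=> [i|i] [j|j] _ _ [t [/= Ei Ej]].
  + by congr inl; apply: tE => //; exists t.
  + by have := dis t (ES _ _ Ei) (FS _ _ Ej).
  + by have := dis t (ES _ _ Ej) (FS _ _ Ei).
  + by congr inr; apply: tF => //; exists t.
- apply/seteqP; split=> t.
    by case=> -[i|i] _ /=; [move=> /ES; left|move=> /FS; right].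
  by case; rewrite -?ESE -?FSE => -[i _ Ei]; [exists (inl i)|exists (inr i)].
Qed.

Lemma partition_subset (I : finType) (E : I -> set (borel G)) S (A : pred I) :
  is_partition E S ->
  is_partition (fun i => if A i then E i else set0) (\bigcup_(i in [set` A]) E i).
Proof.
move=> [mE tE _]; split.
- by move=> i; case: ifP.
- move=> i j _ _ [t []]; case: ifP => // _; case: ifP => // _ Ei Ej.
  by apply: tE => //; exists t.
- apply/seteqP; split=> t [j].
    by move=> _; case: ifP => // Aj Ej; exists j.
  by move=> /= Aj Ej; exists j => //; rewrite [A j]Aj.
Qed.

Lemma partition_mu_fin (I : finType) (E : I -> set (borel G)) S i :
  is_partition E S -> (mu S < +oo)%E -> (mu (E i) < +oo)%E.
Proof.
move=> PE; apply: le_lt_trans; apply: le_measure.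
- by rewrite inE; case: PE.
- by rewrite inE; apply: partition_measurable PE.
- exact: partition_sub PE.
Qed.

Lemma partition_measurable_fun d' (T : measurableType d') (I : finType)
    (E : I -> set (borel G)) S (f : borel G -> T) :
  is_partition E S -> (forall i, measurable_fun (E i) f) -> measurable_fun S f.
Proof.
move=> [mE tE <-] mf mS Y mY; rewrite setI_bigcupl.
by apply: fin_bigcup_measurable => // i _; exact: mf.
Qed.

Lemma partition_integral (I : finType) (E : I -> set (borel G)) S
    (h : borel G -> \bar R) :
  is_partition E S -> measurable_fun S h -> (forall t, S t -> (0 <= h t)%E) ->
  (\int[mu]_(t in S) h t = \sum_i \int[mu]_(t in E i) h t)%E.
Proof.
move=> [mE tE ES].
have <- : \big[setU/set0]_(i <- enum I) E i = S.
  rewrite -ES -bigcup_seq (_ : [set` enum I] = setT)//.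
  by apply/seteqP; split=> // i _ /=; rewrite mem_enum.
move=> mh h0; rewrite ge0_integral_bigsetU ?enum_uniq//.
  by rewrite big_enum.
by apply: sub_trivIset tE.
Qed.

Lemma partition_mu (I : finType) (E : I -> set (borel G)) S :
  is_partition E S -> mu S = (\sum_i mu (E i))%E.
Proof.
move=> PE; rewrite -[mu S]mul1e -integral_cst; last exact: partition_measurable PE.
rewrite (partition_integral PE)//; apply: eq_bigr => i _.
by rewrite integral_cst ?mul1e//; case: PE.
Qed.

Lemma partition_fine_mu (I : finType) (E : I -> set (borel G)) S :
  is_partition E S -> (mu S < +oo)%E -> fine (mu S) = \sum_i fine (mu (E i)).
Proof.
move=> PE muS; rewrite (partition_mu PE) -sum_fine// => i _.
by rewrite ge0_fin_numE ?measure_ge0// (partition_mu_fin i PE).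
Qed.

End Partition.

Section Weight.
Context {R : realType} {G : topologicalZmodType}.
Context {V : completeNormedModType R[i]}.
Variable mu : {measure set (borel G) -> \bar R}.
Implicit Types (S X D : set (borel G)).

(* [0] when [mu X] is infinite *)
Definition weight X : R[i] := (fine (mu X))%:C.

(** Finiteness is asked only where the value is nonzero: a cell of infinite measure with value 0 can
    occur when the domain is all of [G]. *)
Lemma partition_weight (I : finType) (E : I -> set (borel G)) S (v : V) :
  is_partition E S -> (v != 0 -> (mu S < +oo)%E) ->
  weight S *: v = \sum_i weight (E i) *: v.
Proof.
move=> PE; have [-> _|_ /(_ isT) muS] := eqVneq v 0.
  by rewrite scaler0 big1// => i _; rewrite scaler0.
by rewrite -scaler_suml /weight (partition_fine_mu PE muS) rmorph_sum.
Qed.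

Definition step (I : finType) (E : I -> set (borel G)) (c : I -> V) : G -> V :=
  fun t => oapp c 0 [pick i | `[< E i t >]].

Lemma stepE (I : finType) (E : I -> set (borel G)) S (c : I -> V) i t :
  is_partition E S -> E i t -> step E c t = c i.
Proof.
move=> [_ tE _] Ei; rewrite /step; case: pickP => [j /asboolP Ej|/(_ i)] /=.
  by congr c; apply: tE => //; exists t.
by move=> /asboolPn.
Qed.

Lemma step_simple (I : finType) (E : I -> set (borel G)) D (c : I -> V) :
  is_partition E D -> (forall i, c i != 0 -> (mu (E i) < +oo)%E) ->
  integrable_simple mu D (step E c).
Proof.
move=> PE cE; have mE : forall i, measurable (E i) by case: PE.
have DE v : D `&` step E c @^-1` [set v] = \bigcup_(i in [set i | c i = v]) E i.
  apply/seteqP; split=> t.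
    move=> [Dt /= tv]; have [_ _ DE] := PE.
    by move: Dt; rewrite -DE => -[i _ Ei]; exists i => //=; rewrite -tv (stepE c PE Ei).
  move=> [i /= <- Ei]; split; first exact: partition_sub PE _ Ei.
  exact: stepE PE Ei.
have fin v : finite_set [set i | c i = v].
  exact: finite_finset.
split.
- apply: (@sub_finite_set _ _ (c @` setT)); last exact: finite_image.
  move=> _ [t Dt <-]; have [_ _ DE'] := PE.
  by move: Dt; rewrite -DE' => -[i _ Ei]; exists i => //; rewrite (stepE c PE Ei).
- by move=> v; rewrite DE; apply: fin_bigcup_measurable.
- move=> v v0; rewrite DE measure_fin_bigcup//; last first.
    by case: PE => _ tE _; apply: sub_trivIset tE.
  rewrite fsbig_finite// big_seq lte_sum_pinfty// => i.
  by rewrite in_fset_set// inE => /= ci; apply: cE; rewrite ci.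
Qed.


Lemma simple_partition D (s : G -> V) : integrable_simple mu D s ->
  is_partition (fun v : fset_set (s @` D) => D `&` s @^-1` [set val v]) D.
Proof.
move=> [fs ms _]; split; first by move=> v; exact: ms.
- by move=> u v _ _ [t [[_ /= tu] [_ /= tv]]]; apply: val_inj; exact: etrans (esym tu) tv.
- apply/seteqP; split=> t; first by case=> v _ [].
  move=> Dt; have : s t \in s @` D by rewrite inE; exists t.
  rewrite -in_fset_set// => st.
  by exists [` st]%fset.
Qed.

Lemma simple_integralE D (s : G -> V) : integrable_simple mu D s ->
  simple_integral mu D s = \sum_(v : fset_set (s @` D))
    weight (D `&` s @^-1` [set val v]) *: val v.
Proof.
move=> [fs _ _]; rewrite /simple_integral fsbig_finite//.
by rewrite (big_seq_fsetE _ _ predT).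
Qed.

(* Both sums are refined to the common partition by the values of [s] and the
   sets [E i]. *)
Lemma simple_integral_dist (I : finType) (E : I -> set (borel G)) D
    (c : I -> V) (s : G -> V) :
  is_partition E D -> (forall i, c i != 0 -> (mu (E i) < +oo)%E) ->
  integrable_simple mu D s ->
  ((rnorm (simple_integral mu D s - \sum_i weight (E i) *: c i))%:E <=
    \int[mu]_(t in D) (rnorm (s t - step E c t))%:E)%E.
Proof.
move=> PE cE ss; pose F (v : fset_set (s @` D)) : set (borel G) := D `&` s @^-1` [set val v].
have PF : is_partition F D by exact: simple_partition.
pose Q (p : fset_set (s @` D) * I) : set (borel G) := F p.1 `&` E p.2.
have PQ : is_partition Q D by exact: partition_prod.
have EQ i : is_partition (fun v => F v `&` E i) (E i).
  rewrite -[E i in X in is_partition _ X](_ : D `&` E i = _).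
    by apply: partition_setI => //; case: PE.
  exact/setIidPr/(partition_sub PE).
have FQ v : is_partition (fun i => F v `&` E i) (F v).
  have -> : (fun i => F v `&` E i) = (fun i => E i `&` F v).
    by apply/funext => i; rewrite setIC.
  rewrite -[F v in X in is_partition _ X](_ : D `&` F v = _).
    by apply: partition_setI => //; case: PF.
  exact/setIidPr/(partition_sub PF).
have -> : simple_integral mu D s - \sum_i weight (E i) *: c i =
    \sum_(p : fset_set (s @` D) * I) weight (Q p) *: (val p.1 - c p.2).
  rewrite simple_integralE//.
  under eq_bigr => v _.
    rewrite (partition_weight (FQ v)); last by move=> v0; case: ss => _ _; exact.
    over.
  under [X in _ - X]eq_bigr => i _.
    rewrite (partition_weight (EQ i)); last exact: cE.
    over.
  rewrite [X in _ - X]exchange_big/= !pair_big/= -sumrB.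
  by apply: eq_bigr => p _; rewrite scalerBr.
have QE p t : Q p t -> s t - step E c t = val p.1 - c p.2.
  by move=> [[_ /= <-] Ei]; rewrite (stepE c PE Ei).
have mQ p : measurable (Q p) by case: PQ.
rewrite (partition_integral mu PQ); last first.
  by move=> t _; rewrite lee_fin rnorm_ge0.
- apply: (partition_measurable_fun PQ) => p.
  apply: (eq_measurable_fun (cst (rnorm (val p.1 - c p.2))%:E)) => //.
  by move=> t /[!inE] /QE ->.
rewrite (le_trans (lee_tofin (rnorm_sum _ _ _)))// -sumEFin.
apply: lee_sum => p _.
rewrite (eq_integral (cst (rnorm (val p.1 - c p.2))%:E)); last first.
  by move=> t /[!inE] /QE ->.
rewrite integral_cst// rnormZr EFinM muleC lee_wpmul2l//.
  by rewrite lee_fin rnorm_ge0.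
rewrite ger0_norm ?fine_ge0//.
have [fin|] := boolP (mu (Q p) \is a fin_num); first by rewrite fineK.
by rewrite ge0_fin_numE// -leNgt leye_eq => /eqP ->; rewrite leey.
Qed.

End Weight.

(** * Measurability of distances to simple functions *)

Lemma rnorm_continuous (R : realType) (V : normedModType R[i]) :
  continuous (@rnorm R V).
Proof.
move=> v; apply/cvgrPdist_lt => e e0; apply/nbhs_rnormP; exists e => // u uv.
apply: le_lt_trans uv; rewrite ler_norml; apply/andP; split.
  by rewrite lerNl opprB lerBlDr -[in leLHS](subrK v u) rnormD.
by rewrite lerBlDr rnorm_distC -[in leLHS](subrK u v) rnormD.
Qed.

Section Measurability.
Context {R : realType} {G : topologicalZmodType}.
Implicit Types (S D : set (borel G)).

Lemma open_borel (U : set G) : open U -> measurable (U : set (borel G)).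
Proof. by move=> oU; apply: sub_sigma_algebra. Qed.

Lemma closed_borel (C : set G) : closed C -> measurable (C : set (borel G)).
Proof.
move=> cC; rewrite -[C]setCK.
by apply: (@measurableC _ (borel G)); apply: open_borel; exact: closed_openC.
Qed.

Lemma continuous_borel (f : G -> R) D :
  continuous f -> measurable_fun D (f : borel G -> R).
Proof.
move=> /continuousP cf mD.
apply: (measurability _ (RGenOpens.measurableE R)) (mD) => //.
move=> _ [_ [a [b ->] <-]]; apply: measurableI => //.
by apply: open_borel; apply: cf; exact: interval_open.
Qed.

Context {V : completeNormedModType R[i]}.
Variable mu : {measure set (borel G) -> \bar R}.

Lemma measurable_dist_cst (f : G -> V) v D : continuous f ->
  measurable_fun D (fun t : borel G => (rnorm (f t - v))%:E).
Proof.
move=> cf; apply/measurable_EFinP; apply: continuous_borel => t.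
apply: continuous_comp; last exact: rnorm_continuous.
by apply: cvgB; [exact: cf|exact: cvg_cst].
Qed.

(** On each fibre of the simple function this is the distance to a constant, which is continuous in
    [t]. *)
Lemma measurable_dist_simple (f s : G -> V) D :
  continuous f -> integrable_simple mu D s ->
  measurable_fun D (fun t : borel G => (rnorm (f t - s t))%:E).
Proof.
move=> cf ss; apply: (partition_measurable_fun (simple_partition ss)) => v.
apply: (eq_measurable_fun (fun t : borel G => (rnorm (f t - val v))%:E)).
  by move=> t /[!inE] -[_ /= ->].
exact: measurable_dist_cst.
Qed.

Lemma measurable_dist_simple2 (r s : G -> V) D :
  integrable_simple mu D r -> integrable_simple mu D s ->
  measurable_fun D (fun t : borel G => (rnorm (r t - s t))%:E).
Proof.
move=> rr ss; apply: (partition_measurable_fun (simple_partition rr)) => u.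
apply: (eq_measurable_fun (fun t : borel G => (rnorm (val u - s t))%:E)).
  by move=> t /[!inE] -[_ /= ->].
have cst_cont : continuous (cst (val u) : G -> V) by move=> t; exact: cvg_cst.
have m := measurable_dist_simple cst_cont ss.
apply: measurable_funS m; first exact: partition_measurable (simple_partition ss).
by move=> t [].
Qed.

End Measurability.

(** * Riemann sums and existence of Bochner integrals *)

Section RiemannSums.
Context {R : realType} {G : topologicalZmodType} {V : completeNormedModType R[i]}.
Variable mu : {measure set (borel G) -> \bar R}.
Implicit Types (S D : set (borel G)) (f : G -> V).

(** The estimate for simple functions passes to the limit along any approximating sequence, half of
    [e] going to the convergence of the integrals and half to the error in mean. Riemann sums thus
    determine the value, whichever sequence defines it. *)
Lemma bochner_integral_dist (I : finType) (E : I -> set (borel G)) D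
    (c : I -> V) f v :
  continuous f -> is_bochner_integral mu D f v ->
  is_partition E D -> (forall i, c i != 0 -> (mu (E i) < +oo)%E) ->
  ((rnorm (v - \sum_i weight mu (E i) *: c i))%:E <=
    \int[mu]_(t in D) (rnorm (f t - step E c t))%:E)%E.
Proof.
move=> cf [s [ss _ sf] sv] PE cE; have mD := partition_measurable PE.
have rr : integrable_simple mu D (step E c) by exact: step_simple.
apply/lee_addgt0Pr => e e0; have e20 : 0 < e / 2 by rewrite divr_gt0.
have h1 : \forall n \near \oo, rnorm (simple_integral mu D (s n) - v) < e / 2.
  by move/cvg_rnormP : sv; apply.
have h2 : \forall n \near \oo,
    (\int[mu]_(t in D) (rnorm (f t - s n t))%:E < (e / 2)%:E)%E.
  exact: (sf _ (nbhs_open_ereal_lt (f := cst (e / 2)) e20)).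
have [n [h1n h2n]] := filter_ex (filterI h1 h2).
rewrite (@le_trans _ _ ((e / 2)%:E +
    (rnorm (simple_integral mu D (s n) - \sum_i weight mu (E i) *: c i))%:E)%E)//.
  rewrite -EFinD lee_fin (le_trans (rnorm_distD (simple_integral mu D (s n)) _ _))//.
  by rewrite lerD2r rnorm_distC ltW.
rewrite [in leRHS](splitr e) EFinD [leRHS]addeC -addeA leeD2l//.
apply: (le_trans (simple_integral_dist PE cE (ss n))).
have m1 := measurable_dist_simple cf (ss n).
have m2 := measurable_dist_simple cf rr.
have p (u : V) : (0 <= (rnorm u)%:E :> \bar R)%E by rewrite lee_fin rnorm_ge0.
rewrite (@le_trans _ _ (\int[mu]_(t in D)
    ((rnorm (f t - s n t))%:E + (rnorm (f t - step E c t))%:E))%E)//.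
  apply: ge0_le_integral => //.
  - exact: measurable_dist_simple2.
  - exact: emeasurable_funD.
  - move=> t _; rewrite -EFinD lee_fin.
    by rewrite (le_trans (rnorm_distD (f t) _ _))// lerD2r rnorm_distC.
rewrite ge0_integralD// leeD2r// ltW//.
Qed.

Section Approximation.
Variables (S D : set (borel G)) (f : G -> V) (e : R).
Hypotheses (mD : measurable D) (SD : S `<=` D) (muS : (mu S < +oo)%E).
Hypotheses (cf : continuous f) (f0 : forall t, D t -> ~ S t -> f t = 0).
Variables (I : finType) (E : I -> set (borel G)) (c : I -> V).
Hypotheses (PE : is_partition E S) (e0 : 0 <= e).
Hypothesis fc : forall i t, E i t -> rnorm (f t - c i) <= e.

(** The remainder of [D], of possibly infinite measure, becomes one more cell with value 0. An
    integral over a large [D] is thereby reduced to partitions of the set [S] that carries [f]. *)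
Definition ext_cell (s : I + unit) : set (borel G) :=
  match s with inl i => E i | inr _ => D `\` S end.
Definition ext_value (s : I + unit) : V :=
  match s with inl i => c i | inr _ => 0 end.

Lemma ext_partition : is_partition ext_cell D.
Proof.
rewrite -[X in is_partition _ X](setDUK SD).
have mS := partition_measurable PE.
apply: (partition_sum PE (partition_unit _)); first exact: measurableD.
by rewrite setDIK.
Qed.

Lemma ext_finite s : ext_value s != 0 -> (mu (ext_cell s) < +oo)%E.
Proof.
case: s => [i _|_] /=; last by rewrite eqxx.
exact: partition_mu_fin PE muS.
Qed.

Lemma ext_sum : \sum_s weight mu (ext_cell s) *: ext_value s =
  \sum_i weight mu (E i) *: c i.
Proof.
rewrite big_sumType/= [X in _ + X]big1 ?addr0// => i _.
by rewrite scaler0.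
Qed.

Lemma ext_close t : D t ->
  rnorm (f t - step ext_cell ext_value t) <= e * (t \in S)%:R.
Proof.
move=> Dt; have [St|nSt] := boolP (t \in S).
  rewrite mulr1; move: St; rewrite inE; have [_ _ <-] := PE => -[i _ Ei].
  by rewrite (stepE (i := inl i) _ ext_partition Ei) fc.
move: nSt; rewrite notin_setE => nSt; rewrite mulr0.
rewrite (stepE (i := inr tt) _ ext_partition) //=.
by rewrite f0// subrr rnorm0.
Qed.

Lemma ext_integral : (\int[mu]_(t in D)
  (rnorm (f t - step ext_cell ext_value t))%:E <= (e * fine (mu S))%:E)%E.
Proof.
have mS := partition_measurable PE.
apply: (@le_trans _ _ (\int[mu]_(t in D) (e%:E * (\1_S t)%:E))%E).
  apply: ge0_le_integral => //.
  - by move=> t _; rewrite lee_fin rnorm_ge0.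
  - apply: measurable_dist_simple => //.
    exact: (step_simple ext_partition ext_finite).
  - by apply: measurable_funeM; apply/measurable_EFinP; exact: measurable_indic.
  - by move=> t Dt; rewrite -EFinM lee_fin indicE ext_close.
rewrite ge0_integralZl_EFin//; last first.
  by apply/measurable_EFinP; exact: measurable_indic.
rewrite integral_indic// (setIidl SD) EFinM fineK//.
by rewrite ge0_fin_numE.
Qed.

Lemma bochner_riemann v : is_bochner_integral mu D f v ->
  rnorm (v - \sum_i weight mu (E i) *: c i) <= e * fine (mu S).
Proof.
move=> fv; rewrite -lee_fin -ext_sum.
rewrite (le_trans (bochner_integral_dist cf fv ext_partition ext_finite))//.
exact: ext_integral.
Qed.

End Approximation.

End RiemannSums.

Lemma compact_cover_group (G : topologicalZmodType) (A : set G) :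
  compact A -> cover_compact A.
Proof.
pose P : ptopologicalType := HB.pack G (isPointed.Build G (0 : G)).
by rewrite (_ : @compact G = @cover_compact G)//; exact: (@compact_cover P).
Qed.

Section Existence.
Context {R : realType} {G : topologicalZmodType} {V : completeNormedModType R[i]}.
Variable mu : {measure set (borel G) -> \bar R}.
Implicit Types (S D : set (borel G)) (f : G -> V).

Lemma simple_integral_dist2 D (r s : G -> V) :
  integrable_simple mu D r -> integrable_simple mu D s ->
  ((rnorm (simple_integral mu D r - simple_integral mu D s))%:E <=
    \int[mu]_(t in D) (rnorm (r t - s t))%:E)%E.
Proof.
move=> rr ss; rewrite (simple_integralE ss).
have PF := simple_partition ss.
apply: (le_trans (simple_integral_dist PF _ rr)).
  by move=> v v0; case: ss => _ _; apply.
rewrite le_eqVlt; apply/orP; left; apply/eqP; apply: eq_integral => t.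
rewrite inE => Dt; have [_ _ DE] := PF.
move: (Dt); rewrite -{1}DE => -[v _ Fv].
by rewrite (stepE _ PF Fv); case: Fv => _ /= <-.
Qed.

(** Uniform approximation on a set of finite measure yields everything asked of [bochner_approx],
    with convergence at every point of [D]; it also makes the simple integrals Cauchy, so that
    completeness supplies [v]. *)
Lemma bochner_integral_exists S D f :
  measurable D -> measurable S -> S `<=` D -> (mu S < +oo)%E ->
  continuous f -> (forall t, D t -> ~ S t -> f t = 0) ->
  (forall e : R, 0 < e -> exists (I : finType) (E : I -> set (borel G)) (c : I -> V),
    is_partition E S /\ forall i t, E i t -> rnorm (f t - c i) <= e) ->
  exists v, is_bochner_integral mu D f v.
Proof.
move=> mD mS SD muS cf f0 fP; set m := fine (mu S).
have m0 : 0 <= m by rewrite fine_ge0.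
have appr n : exists s : G -> V, [/\ integrable_simple mu D s,
    forall t, D t -> rnorm (f t - s t) <= n.+1%:R^-1 &
    (\int[mu]_(t in D) (rnorm (f t - s t))%:E <= (n.+1%:R^-1 * m)%:E)%E].
  have e0 : 0 < n.+1%:R^-1 :> R by rewrite invr_gt0.
  have [I [E [c [PE fc]]]] := fP _ e0.
  exists (step (ext_cell S D E) (ext_value c)); split.
  - apply: step_simple; first exact: ext_partition.
    by move=> i; exact: ext_finite.
  - move=> t Dt; apply: (le_trans (ext_close mD SD f0 PE fc Dt)).
    by case: (t \in S); rewrite ?mulr1// mulr0 ltW.
  - exact: (ext_integral mD SD muS cf f0 PE (ltW e0) fc).
have [s sP] := choice appr.
have ss n : integrable_simple mu D (s n) by case: (sP n).
have sd n k : rnorm (simple_integral mu D (s n) - simple_integral mu D (s k)) <=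
    n.+1%:R^-1 * m + k.+1%:R^-1 * m.
  have p (u : V) : (0 <= (rnorm u)%:E :> \bar R)%E by rewrite lee_fin rnorm_ge0.
  have m1 := measurable_dist_simple cf (ss n).
  have m2 := measurable_dist_simple cf (ss k).
  rewrite -lee_fin; apply: (le_trans (simple_integral_dist2 (ss n) (ss k))).
  apply: (@le_trans _ _ (\int[mu]_(t in D)
      ((rnorm (f t - s n t))%:E + (rnorm (f t - s k t))%:E))%E).
    apply: ge0_le_integral => //.
    - exact: measurable_dist_simple2.
    - exact: emeasurable_funD.
    - move=> t _; rewrite -EFinD lee_fin.
      by rewrite (le_trans (rnorm_distD (f t) _ _))// lerD2r rnorm_distC.
  rewrite ge0_integralD// EFinD leeD//.
    by case: (sP n).
  by case: (sP k).
have inv_small (e : R) : 0 < e -> \forall n \near \oo, n.+1%:R^-1 * m < e.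
  move=> e0; have e'0 : 0 < e / (m + 1) by rewrite divr_gt0// ltr_wpDl.
  have := near_infty_natSinv_lt (PosNum e'0); apply: filterS => n /= ne.
  rewrite (@le_lt_trans _ _ (n.+1%:R^-1 * (m + 1)))//.
    by rewrite ler_wpM2l// lerDl.
  by rewrite -ltr_pdivlMr// ltr_wpDl.
have [v sv] : exists v : V, (fun n => simple_integral mu D (s n)) @ \oo --> v.
  apply: cauchy_rnorm_cvg => e e0.
  have e2 : 0 < e / 2 by rewrite divr_gt0.
  exists [set n | n.+1%:R^-1 * m < e / 2]; first exact: inv_small.
  move=> n k /= ne ke; rewrite (le_lt_trans (sd n k))//.
  by rewrite [ltRHS]splitr ltrD.
exists v, s => //; split => //.
- apply: aeW => t Dt; apply/cvg_rnormP => e e0.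
  have := near_infty_natSinv_lt (PosNum e0); apply: filterS => n /= ne.
  apply: le_lt_trans ne; rewrite rnorm_distC.
  by case: (sP n) => _ + _; apply.
- apply: (@squeeze_cvge _ _ _ _ (cst 0%E) _ (fun n => (n.+1%:R^-1 * m)%:E)).
  + apply: nearW => n; case: (sP n) => _ _ ->; rewrite andbT.
    by apply: integral_ge0 => t _; rewrite lee_fin rnorm_ge0.
  + exact: cvg_cst.
  + apply: cvg_EFin; first exact: nearW.
    rewrite -(mul0r m); apply: cvgMr_tmp; exact: cvg_harmonic.
Qed.

(** A finite subcover of the compact closure is cut down to [S] and made disjoint by [seqDU]. The
    tags need not lie in [S]. *)
Lemma relatively_compact_partition S (U : G -> set G) :
  relatively_compact S -> (forall t, open (U t)) -> (forall t, U t t) ->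
  exists (I : finType) (E : I -> set (borel G)) (tag : I -> G),
    is_partition E S /\ forall i, E i `<=` U (tag i).
Proof.
move=> [pS mS] oU Ut; have cS : compact (closure S) by rewrite -precompactE.
have [|D' _ SD'] := @compact_cover_group _ _ cS _ setT U (fun t _ => oU t).
  by move=> t _; exists t.
pose s : seq G := enum_fset D'.
pose F k : set (borel G) := S `&` U (nth 0 s k).
have mF k : measurable (F k) by apply: measurableI => //; exact: open_borel.
exists 'I_(size s), (fun i : 'I_(size s) => seqDU F i),
  (fun i : 'I_(size s) => nth 0 s i); split.
  split.
  - by move=> i; exact: seqDU_measurable.
  - move=> i j _ _ [t [ti tj]]; apply: val_inj.
    by apply: (@trivIset_seqDU _ F) => //; exists t.
  - have -> : \bigcup_(i : 'I_(size s)) seqDU F i = \bigcup_(k < size s) seqDU F k.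
      apply/seteqP; split=> t; first by move=> [k _ Fk]; exists k => //=.
      by move=> [k /= ks Fk]; exists (Ordinal ks).
    rewrite bigcup_mkord -bigsetU_seqDU -bigcup_mkord.
    apply/seteqP; split=> t; first by move=> [k _ []].
    move=> St; have [u /= uD' Uu] := SD' t (subset_closure St).
    have us : u \in s by [].
    exists (index u s); first by rewrite /= index_mem.
    by split => //; rewrite nth_index.
by move=> i t Fi; have [] := @subset_seqDU _ F i t Fi.
Qed.

End Existence.

(** * Integrals of continuous functions over relatively compact sets *)

Section ContinuousIntegral.
Context {R : realType} {G : topologicalZmodType}.
Variable mu : {measure set (borel G) -> \bar R}.
Hypothesis haar : haar_measure mu.
Implicit Types (S : set (borel G)).

Lemma relatively_compact_mu S : relatively_compact S -> (mu S < +oo)%E.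
Proof.
move=> [pS mS]; have cS : compact (closure S) by rewrite -precompactE.
apply: le_lt_trans (haar_compact haar cS); apply: le_measure.
- by rewrite inE.
- by rewrite inE; apply: closed_borel; exact: closed_closure.
- exact: subset_closure.
Qed.

(** Two functions share one partition and its tags, so that Riemann sums of related functions can be
    compared term by term. *)
Lemma riemann_partition (V W : normedModType R[i]) S (f : G -> V) (g : G -> W)
    (e : R) :
  relatively_compact S -> continuous f -> continuous g -> 0 < e ->
  exists (I : finType) (E : I -> set (borel G)) (tag : I -> G),
    [/\ is_partition E S, forall i t, E i t -> rnorm (f t - f (tag i)) <= e &
      forall i t, E i t -> rnorm (g t - g (tag i)) <= e].
Proof.
move=> rS cf cg e0.
have oB (X : normedModType R[i]) (h : G -> X) t : continuous h ->
    open [set u | rnorm (h u - h t) < e].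
  move=> ch; rewrite (_ : mkset _ = h @^-1` ball (h t) e%:C).
    by apply: open_comp; [move=> u _; exact: ch|exact: ball_open].
  by apply/seteqP; split=> u; rewrite -ball_normE /= normE ltcR rnorm_distC.
pose U t := [set u | rnorm (f u - f t) < e] `&` [set u | rnorm (g u - g t) < e].
have oU t : open (U t) by apply: openI; exact: oB.
have [|I [E [tag [PE EU]]]] := relatively_compact_partition rS oU.
  by move=> t; split => /=; rewrite subrr rnorm0.
by exists I, E, tag; split=> // i t /EU [/= h1 h2]; exact: ltW.
Qed.

Lemma relatively_compact_bounded (V : normedModType R[i]) S (f : G -> V) :
  relatively_compact S -> continuous f ->
  exists2 M, 0 <= M & forall t, S t -> rnorm (f t) <= M.
Proof.
move=> rS cf; have [I [E [tag [[_ _ ES] fE _]]]] := riemann_partition rS cf cf ltr01.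
have s0 : 0 <= \sum_i rnorm (f (tag i)) by apply: sumr_ge0 => i _; exact: rnorm_ge0.
exists (1 + \sum_i rnorm (f (tag i))); first by rewrite addr_ge0.
move=> t; rewrite -ES => -[i _ Ei].
rewrite -(subrK (f (tag i)) (f t)) (le_trans (rnormD _ _))// lerD ?fE//.
by rewrite (bigD1 i)//= lerDl sumr_ge0// => j _; exact: rnorm_ge0.
Qed.

Context {V : completeNormedModType R[i]}.
Implicit Types (f : G -> V).

Lemma bochner_integralP S D f : measurable D -> S `<=` D ->
  relatively_compact S -> continuous f -> (forall t, D t -> ~ S t -> f t = 0) ->
  is_bochner_integral mu D f (bochner_integral mu D f).
Proof.
move=> mD SD rS cf f0; apply: xgetPex.
apply: (bochner_integral_exists mD _ SD (relatively_compact_mu rS) cf f0).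
  by case: rS.
move=> e e0; have [I [E [tag [PE fE _]]]] := riemann_partition rS cf cf e0.
by exists I, E, (fun i => f (tag i)).
Qed.

Lemma bochner_integrable_continuous S f : relatively_compact S ->
  continuous f -> bochner_integrable mu S f.
Proof.
move=> rS cf; have mS : measurable S by case: rS.
by have [s sP _] := bochner_integralP mS (@subset_refl _ S) rS cf
  (fun t St nSt => False_ind _ (nSt St)); exists s.
Qed.

Lemma bochner_integral_riemann_ext (I : finType) (E : I -> set (borel G)) S D f
    (c : I -> V) (e : R) : measurable D -> S `<=` D ->
  relatively_compact S -> continuous f -> (forall t, D t -> ~ S t -> f t = 0) ->
  is_partition E S -> 0 <= e ->
  (forall i t, E i t -> rnorm (f t - c i) <= e) ->
  rnorm (bochner_integral mu D f - \sum_i weight mu (E i) *: c i) <=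
    e * fine (mu S).
Proof.
move=> mD SD rS cf f0 PE e0 fE.
apply: (bochner_riemann mD SD (relatively_compact_mu rS) cf f0 PE e0 fE).
exact: bochner_integralP SD rS cf f0.
Qed.

Lemma bochner_integral_riemann (I : finType) (E : I -> set (borel G)) S f
    (c : I -> V) (e : R) :
  relatively_compact S -> continuous f -> is_partition E S -> 0 <= e ->
  (forall i t, E i t -> rnorm (f t - c i) <= e) ->
  rnorm (bochner_integral mu S f - \sum_i weight mu (E i) *: c i) <=
    e * fine (mu S).
Proof.
move=> rS cf PE e0 fE; apply: bochner_integral_riemann_ext => //.
by case: rS.
Qed.

Lemma bochner_integral_support S D f : measurable D -> S `<=` D ->
  relatively_compact S -> continuous f -> (forall t, D t -> ~ S t -> f t = 0) ->
  bochner_integral mu D f = bochner_integral mu S f.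
Proof.
move=> mD SD rS cf f0; apply/eqP; rewrite -subr_eq0; apply/eqP.
apply: (@rnorm_small _ _ _ (2 * fine (mu S))) => e e0.
have [I [E [tag [PE fE _]]]] := riemann_partition rS cf cf e0.
have h1 := bochner_integral_riemann_ext mD SD rS cf f0 PE (ltW e0) fE.
have h2 := bochner_integral_riemann rS cf PE (ltW e0) fE.
rewrite mulrCA mulr_natl mulr2n (le_trans (rnorm_distD _ _ _) (lerD h1 _))//.
by rewrite rnorm_distC.
Qed.

Lemma rnorm_bochner_integral S f (M : R) :
  relatively_compact S -> continuous f -> 0 <= M ->
  (forall t, S t -> rnorm (f t) <= M) ->
  rnorm (bochner_integral mu S f) <= M * fine (mu S).
Proof.
move=> rS cf M0 fM; have mS : measurable S by case: rS.
(* With one cell of value 0 the Riemann sum vanishes and its error bound is the claim. Tags may lie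
   outside [S], where [M] bounds nothing. *)
have f0M (i : unit) t : S t -> rnorm (f t - (cst 0 : unit -> V) i) <= M.
  by move=> St; rewrite subr0 fM.
have := bochner_integral_riemann rS cf (partition_unit mS) M0 f0M.
by rewrite big1 ?subr0// => i _; exact: scaler0.
Qed.

Lemma bochner_integralZD S f g (k : R[i]) :
  relatively_compact S -> continuous f -> continuous g ->
  bochner_integral mu S (fun t => k *: f t + g t) =
    k *: bochner_integral mu S f + bochner_integral mu S g.
Proof.
move=> rS cf cg; apply/eqP; rewrite -subr_eq0; apply/eqP.
set K := rnorm (k : R[i]^o); have K0 : 0 <= K by exact: rnorm_ge0.
have ckf : continuous (fun t => k *: f t + g t).
  by move=> t; apply: cvgD; [apply: cvgZr; exact: cf|exact: cg].
apply: (@rnorm_small _ _ _ ((K + 1) * fine (mu S) * 2)) => e e0.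
have [I [E [tag [PE fE gE]]]] := riemann_partition rS cf cg e0.
have h1 := bochner_integral_riemann rS cf PE (ltW e0) fE.
have h2 := bochner_integral_riemann rS cg PE (ltW e0) gE.
have e'0 : 0 <= (K + 1) * e by rewrite mulr_ge0 ?addr_ge0// ltW.
have kfE i t : E i t ->
    rnorm (k *: f t + g t - (k *: f (tag i) + g (tag i))) <= (K + 1) * e.
  move=> Ei; rewrite opprD addrACA -scalerBr (le_trans (rnormD _ _))//.
  by rewrite rnormZ mulrDl mul1r lerD ?gE// ler_wpM2l ?fE.
have h3 := bochner_integral_riemann rS ckf PE e'0 kfE.
set x := bochner_integral _ _ _ in h3 *.
set y := bochner_integral _ _ _ in h1 *; set z := bochner_integral _ _ _ in h2 *.
set a := \sum_i _ in h1; set b := \sum_i _ in h2.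
rewrite (_ : \sum_i _ = k *: a + b) in h3; last first.
  rewrite scaler_sumr -big_split/=; apply: eq_bigr => i _.
  by rewrite scalerDr !scalerA mulrC.
rewrite (le_trans (rnorm_distD (k *: a + b) _ _))//.
rewrite (_ : e * _ = (K + 1) * e * fine (mu S) + (K + 1) * e * fine (mu S)).
  rewrite lerD// opprD addrACA -scalerBr (le_trans (rnormD _ _))//.
  rewrite rnormZ mulrDl mul1r mulrDl lerD//; last by rewrite rnorm_distC.
  by rewrite -mulrA ler_wpM2l// rnorm_distC.
by ring.
Qed.

End ContinuousIntegral.

Lemma linear_rnorm_continuous (R : realType) (V W : normedModType R[i])
    (T : {linear V -> W}) (M : R) :
  (forall v, rnorm (T v) <= M * rnorm v) -> continuous T.
Proof.
move=> TM v; apply/cvg_rnormP => e e0; have M0 : 0 < `|M| + 1 by rewrite ltr_wpDl.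
apply/nbhs_rnormP; exists (e / (`|M| + 1)); first by rewrite divr_gt0.
move=> u uv; rewrite -linearB (le_lt_trans (TM _))//.
rewrite (@le_lt_trans _ _ ((`|M| + 1) * rnorm (u - v)))//.
  by rewrite ler_wpM2r ?rnorm_ge0// (le_trans (ler_norm _))// lerDl.
by rewrite mulrC -ltr_pdivlMr.
Qed.

(** * Finite sums with scalar coefficients of modulus at most 1 *)

Section Modulation.
Context {R : realType} {V : normedModType R[i]}.

Lemma rnorm_convex (u v : V) (p M : R) : 0 <= p <= 1 ->
  rnorm u <= M -> rnorm v <= M -> rnorm ((1 - p)%:C *: u + p%:C *: v) <= M.
Proof.
move=> /andP[p0 p1] uM vM; rewrite (le_trans (rnormD _ _))//.
rewrite !rnormZr !ger0_norm ?subr_ge0//.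
rewrite (_ : M = (1 - p) * M + p * M); last by ring.
by rewrite lerD// ler_wpM2l// subr_ge0.
Qed.

(** The sum is a convex combination of subset sums. Each induction step interpolates between
    dropping the head and moving it into [u], which collects the terms chosen so far. *)
Lemma rnorm_sum01 (I : eqType) (s : seq I) (w : I -> V) (p : I -> R) (M : R) u :
  uniq s -> (forall i, 0 <= p i <= 1) ->
  (forall A : pred I, rnorm (u + \sum_(i <- s | A i) w i) <= M) ->
  rnorm (u + \sum_(i <- s) (p i)%:C *: w i) <= M.
Proof.
move=> + p01; elim: s u => [|x s ih] u /=.
  by move=> _ /(_ predT); rewrite !big_nil.
move=> /andP[xs us] sM; rewrite big_cons.
set Y := \sum_(j <- s) _.
rewrite (_ : u + _ = (1 - p x)%:C *: (u + Y) + (p x)%:C *: (u + w x + Y)).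
  have same (b : bool) (A : pred I) : \sum_(i <- s | if i == x then b else A i) w i =
      \sum_(i <- s | A i) w i.
    rewrite big_seq_cond [RHS]big_seq_cond; apply: eq_bigl => i.
    by case: eqVneq => [->|//]; rewrite (negPf xs).
  apply: rnorm_convex => //; apply: ih => // A.
    have := sM (fun i => if i == x then false else A i).
    by rewrite big_cons eqxx same.
  have := sM (fun i => if i == x then true else A i).
  by rewrite big_cons eqxx same addrA.
rewrite -[u + w x + Y]addrA [w x + Y]addrC addrA [(p x)%:C *: (_ + w x)]scalerDr.
rewrite [RHS]addrA -scalerDl -rmorphD/= subrK scale1r addrA.
by rewrite -!addrA [_ *: _ + _]addrC.
Qed.

(* Split the real and imaginary parts of the coefficients into positive and
   negative parts, each with values in [0, 1]. *)
Lemma rnorm_sum_bounded_coef (I : finType) (w : I -> V) (c : I -> R[i]) (M : R) :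
  (forall i, rnorm (c i : R[i]^o) <= 1) ->
  (forall A : pred I, rnorm (\sum_(i | A i) w i) <= M) ->
  rnorm (\sum_i c i *: w i) <= 4 * M.
Proof.
move=> c1 wM.
have S01 (p : I -> R) : (forall i, 0 <= p i <= 1) ->
    rnorm (\sum_i (p i)%:C *: w i) <= M.
  move=> p01; rewrite -[X in rnorm X]add0r.
  by apply: rnorm_sum01 (index_enum_uniq I) p01 _ => A; rewrite add0r.
pose pos (x : R) := Num.max x 0.
have posE x : x = pos x - pos (- x).
  by rewrite /pos; case: (leP x 0) => x0; case: (leP (- x) 0) => y0; lra.
have pos01 x : `|x| <= 1 -> 0 <= pos x <= 1.
  by move=> x1; rewrite /pos le_max lexx orbT ge_max (le_trans (ler_norm _) x1) ler01.
have Re1 i : `|complex.Re (c i)| <= 1.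
  apply: le_trans (c1 i); rewrite /rnorm normc_def /= -sqrtr_sqr.
  by rewrite ler_wsqrtr// lerDl sqr_ge0.
have Im1 i : `|complex.Im (c i)| <= 1.
  apply: le_trans (c1 i); rewrite /rnorm normc_def /= -sqrtr_sqr.
  by rewrite ler_wsqrtr// lerDr sqr_ge0.
have cE i : c i = (pos (complex.Re (c i)))%:C - (pos (- complex.Re (c i)))%:C +
    'i%C * ((pos (complex.Im (c i)))%:C - (pos (- complex.Im (c i)))%:C).
  by rewrite -!rmorphB -!posE [LHS]complexE.
rewrite (eq_bigr (fun i => (pos (complex.Re (c i)))%:C *: w i -
    (pos (- complex.Re (c i)))%:C *: w i +
    'i%C *: ((pos (complex.Im (c i)))%:C *: w i -
    (pos (- complex.Im (c i)))%:C *: w i))); last first.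
  by move=> i _; rewrite {1}cE scalerDl -scalerA !scalerBl.
rewrite big_split/= -scaler_sumr !sumrB.
rewrite (le_trans (rnormD _ _))// rnormZ (_ : rnorm ('i%C : R[i]^o) = 1); last first.
  by rewrite /rnorm normc_def /= expr0n expr1n add0r sqrtr1.
rewrite mul1r (_ : 4 * M = (M + M) + (M + M)); last by ring.
by rewrite lerD// (le_trans (rnormB _ _))// lerD// S01// => i;
  apply: pos01; rewrite ?normrN.
Qed.

End Modulation.

(** * Bounded operators, additivity, translation and modulation of integrals *)

Section IntegralOperations.
Context {R : realType} {G : topologicalZmodType} {V : completeNormedModType R[i]}.
Variable mu : {measure set (borel G) -> \bar R}.
Hypothesis haar : haar_measure mu.
Implicit Types (S K L : set (borel G)) (f : G -> V).

Lemma relatively_compact0 : relatively_compact (set0 : set (borel G)).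
Proof.
split; last exact: measurable0.
by rewrite precompactE closure0; exact: compact0.
Qed.

Lemma relatively_compactU K L :
  relatively_compact K -> relatively_compact L -> relatively_compact (K `|` L).
Proof.
move=> [pK mK] [pL mL]; split; last exact: measurableU.
rewrite precompactE closureU; apply: compactU; by rewrite -precompactE.
Qed.

Lemma relatively_compact_sub K L :
  relatively_compact K -> measurable L -> L `<=` K -> relatively_compact L.
Proof. by move=> [pK _] mL LK; split => //; exact: precompact_subset LK pK. Qed.

Lemma relatively_compactD K L :
  relatively_compact K -> relatively_compact L -> relatively_compact (K `\` L).
Proof.
move=> rK [_ mL]; apply: (relatively_compact_sub rK); last exact: subDsetl.
by apply: measurableD => //; case: rK.
Qed.

Lemma bochner_integral_linear (W : completeNormedModType R[i]) S f
    (T : {linear V -> W}) (M : R) :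
  relatively_compact S -> continuous f -> 0 <= M ->
  (forall v, rnorm (T v) <= M * rnorm v) ->
  bochner_integral mu S (fun t => T (f t)) = T (bochner_integral mu S f).
Proof.
move=> rS cf M0 TM; apply/eqP; rewrite -subr_eq0; apply/eqP.
have cTf : continuous (fun t => T (f t)).
  move=> t; apply: continuous_comp; first exact: cf.
  exact: linear_rnorm_continuous TM _.
apply: (@rnorm_small _ _ _ (M * fine (mu S) * 2)) => e e0.
have [I [E [tag [PE fE _]]]] := riemann_partition rS cf cf e0.
have h1 := bochner_integral_riemann haar rS cf PE (ltW e0) fE.
have e'0 : 0 <= M * e by rewrite mulr_ge0// ltW.
have TfE i t : E i t -> rnorm (T (f t) - T (f (tag i))) <= M * e.
  by move=> Ei; rewrite -linearB (le_trans (TM _))// ler_wpM2l ?fE.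
have h2 := bochner_integral_riemann haar rS cTf PE e'0 TfE.
set x := bochner_integral _ _ _ in h2 *.
set y := bochner_integral _ _ _ in h1 *.
set a := \sum_i _ in h1.
rewrite (_ : \sum_i _ = T a) in h2; last first.
  by rewrite linear_sum; apply: eq_bigr => i _; rewrite linearZ.
rewrite (le_trans (rnorm_distD (T a) _ _))//.
rewrite (_ : e * _ = M * e * fine (mu S) + M * (e * fine (mu S))); last by ring.
rewrite lerD// -linearB (le_trans (TM _))// ler_wpM2l// rnorm_distC//.
Qed.

Lemma bochner_integralU K L f :
  relatively_compact K -> relatively_compact L -> K `&` L = set0 ->
  continuous f ->
  bochner_integral mu (K `|` L) f =
    bochner_integral mu K f + bochner_integral mu L f.
Proof.
move=> rK rL KL cf; have rU := relatively_compactU rK rL.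
apply/eqP; rewrite -subr_eq0; apply/eqP.
apply: (@rnorm_small _ _ _ (fine (mu (K `|` L)) + fine (mu K) + fine (mu L))).
move=> e e0.
have [I [E [tag [PE fE _]]]] := riemann_partition rK cf cf e0.
have [J [F [tag' [PF fF _]]]] := riemann_partition rL cf cf e0.
have h1 := bochner_integral_riemann haar rK cf PE (ltW e0) fE.
have h2 := bochner_integral_riemann haar rL cf PF (ltW e0) fF.
pose c (s : I + J) := match s with inl i => f (tag i) | inr j => f (tag' j) end.
have PU := partition_sum PE PF KL.
have fU (s : I + J) t : match s with inl i => E i | inr j => F j end t ->
    rnorm (f t - c s) <= e.
  by case: s => [i|j] /=; [exact: fE|exact: fF].
have := bochner_integral_riemann haar rU cf PU (ltW e0) fU.
rewrite big_sumType/=; set a := \sum_i _ in h1 *; set b := \sum_i _ in h2 * => h3.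
rewrite (le_trans (rnorm_distD (a + b) _ _))// -[X in e * X]addrA mulrDr lerD//.
rewrite opprD addrACA (le_trans (rnormD _ _))// mulrDr lerD//.
  by rewrite rnorm_distC.
by rewrite rnorm_distC.
Qed.

Lemma bochner_integralD K L f :
  relatively_compact K -> relatively_compact L -> L `<=` K -> continuous f ->
  bochner_integral mu (K `\` L) f =
    bochner_integral mu K f - bochner_integral mu L f.
Proof.
move=> rK rL LK cf; rewrite -[in bochner_integral mu K f](setDUK LK).
rewrite bochner_integralU//; first by rewrite addrAC subrr add0r.
  exact: relatively_compactD.
by rewrite setDIK.
Qed.

Definition shift_set (s : G) (K : set (borel G)) : set (borel G) :=
  [set (s + t : G) | t in K].

Lemma shift_setE s K : shift_set s K = (fun t : G => - s + t) @^-1` K.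
Proof.
apply/seteqP; split=> t.
  by move=> [u Ku <-] /=; rewrite addKr.
by move=> Kt; exists (- s + t) => //; rewrite addNKr.
Qed.

Lemma shift_continuous (s : G) : continuous (fun t : G => s + t).
Proof.
move=> t; apply: (@continuous_comp _ _ _ (fun u : G => (s, u))
  (fun p : G * G => p.1 + p.2)); last exact: add_continuous.
by apply: cvg_pair; [exact: cvg_cst|exact: cvg_id].
Qed.

Lemma shift_measurable s K : measurable K -> measurable (shift_set s K).
Proof.
move=> mK; rewrite shift_setE -[X in measurable X]setTI.
have m : measurable_fun (setT : set (borel G)) (fun t : G => - s + t : borel G).
  apply: (@measurability _ _ (borel G) (borel G) setT _ (@open G)) => //.
  move=> _ [U oU <-]; rewrite setTI; apply: open_borel.
  by apply: open_comp oU => t _; exact: shift_continuous.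
exact: m.
Qed.

Lemma relatively_compact_shift s K :
  relatively_compact K -> relatively_compact (shift_set s K).
Proof.
move=> [[C KC [cC clC]] mK]; split; last exact: shift_measurable.
exists (shift_set s C); first by move=> _ [t Kt <-]; exists t => //; exact: KC.
split; last first.
  rewrite shift_setE; apply: closed_comp clC => t _; exact: shift_continuous.
apply: continuous_compact cC; apply: continuous_subspaceT.
exact: shift_continuous.
Qed.

(** Translating a partition keeps its weights, by invariance of [mu], so one Riemann sum serves both
    integrals. *)
Lemma bochner_integral_shift s K f : relatively_compact K -> continuous f ->
  bochner_integral mu K (fun t => f (s + t)) =
    bochner_integral mu (shift_set s K) f.
Proof.
move=> rK cf; apply/eqP; rewrite -subr_eq0; apply/eqP.
have cfs : continuous (fun t => f (s + t)).
  by move=> t; apply: continuous_comp; [exact: shift_continuous|exact: cf].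
have rsK := relatively_compact_shift s rK.
have mK : measurable K by case: rK.
apply: (@rnorm_small _ _ _ (fine (mu K) + fine (mu K))) => e e0.
have [I [E [tag [PE fE _]]]] := riemann_partition rK cfs cfs e0.
have h1 := bochner_integral_riemann haar rK cfs PE (ltW e0) fE.
have PsE : is_partition (fun i => shift_set s (E i)) (shift_set s K).
  have [mE tE EK] := PE; split.
  - by move=> i; exact: shift_measurable.
  - move=> i j _ _ [t []]; rewrite !shift_setE => Ei Ej.
    by apply: tE => //; exists (- s + t).
  - rewrite shift_setE -EK preimage_bigcup.
    by apply: eq_bigcupr => i _; rewrite shift_setE.
have fsE i t : shift_set s (E i) t -> rnorm (f t - f (s + tag i)) <= e.
  by move=> [u Eu <-]; exact: fE.
have := bochner_integral_riemann haar rsK cf PsE (ltW e0) fsE.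
have muE E' : measurable E' -> mu (shift_set s E') = mu E'.
  by move=> mE'; rewrite -[RHS](haar_invariant haar s mE').
rewrite muE// (eq_bigr (fun i => weight mu (E i) *: f (s + tag i))); last first.
  by move=> i _; rewrite /weight muE//; case: PE.
set a := \sum_i _ in h1 * => h2.
by rewrite (le_trans (rnorm_distD a _ _))// mulrDr lerD// rnorm_distC.
Qed.

(** In the Riemann sum the values of [phi] are coefficients of modulus at most 1, and each subsum of
    the terms [weight mu (E i) *: f (tag i)] approximates the integral of [f] over the union of the
    chosen cells, where [M] applies. *)
Lemma bochner_integral_modulated S f (phi : G -> R[i]) (M : R) :
  relatively_compact S -> continuous f -> continuous (phi : G -> R[i]^o) ->
  (forall t, rnorm (phi t : R[i]^o) <= 1) ->
  (forall L, measurable L -> L `<=` S -> rnorm (bochner_integral mu L f) <= M) ->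
  rnorm (bochner_integral mu S (fun t => phi t *: f t)) <= 4 * M.
Proof.
move=> rS cf cphi phi1 fM; apply/ler_addgt0Pr => d d0.
have cphif : continuous (fun t => phi t *: f t).
  by move=> t; apply: cvgZ; [exact: cphi|exact: cf].
set m := fine (mu S); have m0 : 0 <= m by rewrite fine_ge0.
(* One error [e * m] comes from the Riemann sum of the product, four more from those of [f] over
   unions of cells; the [+ 1] covers [m = 0]. *)
pose e := d / (5 * (m + 1)).
have e0 : 0 < e by rewrite divr_gt0// mulr_gt0// ltr_wpDl.
have em : e * m + 4 * (e * m) <= d.
  have -> : e * m + 4 * (e * m) = d * (m / (m + 1)).
    by rewrite /e; field; rewrite gt_eqF// ltr_wpDl.
  by rewrite ler_piMr ?(ltW d0)// ler_pdivrMr ?ltr_wpDl// mul1r lerDl.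
have [I [E [tag [PE fE gE]]]] := riemann_partition rS cf cphif e0.
have h := bochner_integral_riemann haar rS cphif PE (ltW e0) gE.
set a := \sum_i _ in h.
rewrite -(subrK a (bochner_integral _ _ _)) (le_trans (rnormD _ _))//.
apply: (@le_trans _ _ (e * m + 4 * (M + e * m))); last first.
  by rewrite mulrDr addrCA lerD2l.
rewrite lerD// (_ : a = \sum_i phi (tag i) *: (weight mu (E i) *: f (tag i))).
  apply: rnorm_sum_bounded_coef => // A.
  pose L := \bigcup_(i in [set` A]) E i.
  have PL : is_partition (fun i => if A i then E i else set0) L.
    exact: partition_subset PE.
  have LS : L `<=` S by move=> t [i _]; exact: (partition_sub PE).
  have mL := partition_measurable PL.
  have rL : relatively_compact L by exact: relatively_compact_sub LS.
  have fL i t : (if A i then E i else set0) t -> rnorm (f t - f (tag i)) <= e.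
    by case: ifP => // _; exact: fE.
  have := bochner_integral_riemann haar rL cf PL (ltW e0) fL.
  rewrite (eq_bigr (fun i => if A i then weight mu (E i) *: f (tag i) else 0)).
    rewrite -big_mkcond/= => h2.
    rewrite -(subrK (bochner_integral mu L f) (\sum_(i | _) _)).
    rewrite (le_trans (rnormD _ _))// addrC lerD ?fM// rnorm_distC.
    rewrite (le_trans h2)// ler_wpM2l ?(ltW e0)// /m.
    have fin K : relatively_compact K -> mu K \is a fin_num.
      by move=> rK; rewrite ge0_fin_numE//; exact: relatively_compact_mu rK.
    apply: fine_le; [exact: fin|exact: fin|].
    by apply: le_measure; rewrite ?inE//; case: rS.
  move=> i _; case: ifP => // _.
  by rewrite /weight measure0 scale0r.
by apply: eq_bigr => i _; rewrite !scalerA mulrC.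
Qed.

End IntegralOperations.

(** * Unconditional integrability as a condition on tails *)

Section UnconditionalIntegral.
Context {R : realType} {G : topologicalZmodType} {V : completeNormedModType R[i]}.
Variable mu : {measure set (borel G) -> \bar R}.
Hypothesis haar : haar_measure mu.
Implicit Types (S K L : set (borel G)) (f : G -> V).

#[global] Instance relcompact_net_filter : ProperFilter (@relcompact_net G).
Proof.
apply: filter_from_proper; last by move=> K rK; exists K; split.
apply: filter_from_filter; first by exists set0; exact: relatively_compact0.
move=> K L rK rL; exists (K `|` L); first exact: relatively_compactU.
move=> S [rS KLS]; split; split=> //; apply: subset_trans KLS.
  exact: subsetUl.
exact: subsetUr.
Qed.

Lemma relcompact_net_rnormP (F : set (borel G) -> V) v :
  F K @[K --> @relcompact_net G] --> v <->
  forall e : R, 0 < e -> exists2 K0, relatively_compact K0 &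
    forall K, relatively_compact K -> K0 `<=` K -> rnorm (F K - v) < e.
Proof.
split=> [/cvg_rnormP Fv e /Fv[K0 rK0 K0P]|Fv].
  by exists K0 => // K rK K0K; exact: K0P.
by apply/cvg_rnormP => e /Fv[K0 rK0 K0P]; exists K0 => // K [rK K0K]; exact: K0P.
Qed.

Lemma uncond_integral_unique f v w :
  is_uncond_integral mu f v -> is_uncond_integral mu f w -> v = w.
Proof. by move=> [_ fv] [_ fw]; apply: (cvg_unique (@norm_hausdorff _ V) fv fw). Qed.

(** One half of a Cauchy criterion: the integral over [L] is the difference of those over [K0] with
    and without [L], and both sets are far along the net. The next lemma is the converse. *)
Lemma uncond_integral_tail f (e : R) : continuous f -> uncond_integrable mu f ->
  0 < e -> exists2 K0, relatively_compact K0 & forall L, relatively_compact L ->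
    L `&` K0 = set0 -> rnorm (bochner_integral mu L f) <= e.
Proof.
move=> cf [v [_ /relcompact_net_rnormP fv]] e0.
have [|K0 rK0 K0P] := fv (e / 2); first by rewrite divr_gt0.
exists K0 => // L rL LK0.
have rU := relatively_compactU rL rK0.
have h := K0P _ rU (@subsetUr _ _ _).
rewrite -(_ : bochner_integral mu (L `|` K0) f - bochner_integral mu K0 f =
    bochner_integral mu L f); last by rewrite bochner_integralU// addrK.
rewrite (le_trans (rnorm_distD v _ _))// [leRHS]splitr lerD//; first exact: ltW.
by rewrite rnorm_distC ltW// K0P.
Qed.

Lemma tail_uncond_integrable f : continuous f ->
  (forall e : R, 0 < e -> exists2 K0, relatively_compact K0 &
    forall L, relatively_compact L -> L `&` K0 = set0 ->
      rnorm (bochner_integral mu L f) <= e) ->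
  uncond_integrable mu f.
Proof.
move=> cf tail.
suff [v fv] : exists v : V, bochner_integral mu K f @[K --> @relcompact_net G] --> v.
  by exists v; split => // K rK; exact: bochner_integrable_continuous.
apply: cauchy_rnorm_cvg => e e0.
have [|K0 rK0 K0P] := tail (e / 3); first by rewrite divr_gt0.
exists [set K | relatively_compact K /\ K0 `<=` K]; first by exists K0.
have small K : relatively_compact K -> K0 `<=` K ->
    rnorm (bochner_integral mu K f - bochner_integral mu K0 f) <= e / 3.
  move=> rK K0K; rewrite -bochner_integralD// K0P//.
    exact: relatively_compactD.
  by rewrite setIC setDIK.
move=> K L [rK K0K] [rL K0L].
rewrite (le_lt_trans (rnorm_distD (bochner_integral mu K0 f) _ _))//.
rewrite (@le_lt_trans _ _ (e / 3 + e / 3))//; last by lra.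
by rewrite lerD ?small// rnorm_distC small.
Qed.

(** A measurable subset of a relatively compact set disjoint from [K0] is another such set, so the
    tail estimate bounds all the subset integrals that [bochner_integral_modulated] asks for. *)
Lemma uncond_integrable_modulated f (phi : G -> R[i]) :
  continuous f -> continuous (phi : G -> R[i]^o) ->
  (forall t, rnorm (phi t : R[i]^o) <= 1) ->
  uncond_integrable mu f -> uncond_integrable mu (fun t => phi t *: f t).
Proof.
move=> cf cphi phi1 uf; apply: tail_uncond_integrable.
  by move=> t; apply: cvgZ; [exact: cphi|exact: cf].
move=> e e0; have [|K0 rK0 K0P] := uncond_integral_tail cf uf (e := e / 4).
  by rewrite divr_gt0.
exists K0 => // L rL LK0.
rewrite (_ : e = 4 * (e / 4)); last by field.
apply: (bochner_integral_modulated haar rL cf cphi phi1) => L' mL' L'L.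
apply: K0P; first exact: relatively_compact_sub L'L.
by apply/seteqP; split=> // t [/L'L Lt K0t]; rewrite -LK0.
Qed.

(** This is the pointwise bound for the uniform boundedness principle, hence independent of [phi]
    and [K]. On [K0] the function is bounded and the measure finite; off [K0] the integrals of [f]
    are at most 1, hence at most 4 after modulation. *)
Lemma uncond_integrable_bounded f : continuous f -> uncond_integrable mu f ->
  exists M : R, forall (phi : G -> R[i]) K,
    continuous (phi : G -> R[i]^o) -> (forall t, rnorm (phi t : R[i]^o) <= 1) ->
    relatively_compact K ->
    rnorm (bochner_integral mu K (fun t => phi t *: f t)) <= M.
Proof.
move=> cf uf; have [K0 rK0 K0P] := uncond_integral_tail cf uf ltr01.
have [B B0 fB] := relatively_compact_bounded rK0 cf.
exists (B * fine (mu K0) + 4 * 1) => phi K cphi phi1 rK.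
have cphif : continuous (fun t => phi t *: f t).
  by move=> t; apply: cvgZ; [exact: cphi|exact: cf].
have [mK mK0] : measurable K /\ measurable K0 by split; [case: rK|case: rK0].
have rI : relatively_compact (K0 `&` K).
  by apply: (relatively_compact_sub rK0); [exact: measurableI|move=> t []].
have rD := relatively_compactD rK rK0.
have KE : K = (K0 `&` K) `|` (K `\` K0).
  by apply/seteqP; split=> t; [case: (pselect (K0 t)); [left|right]|case=> -[]].
have dis : (K0 `&` K) `&` (K `\` K0) = set0.
  by apply/seteqP; split=> t // -[[? _] [_]].
rewrite KE bochner_integralU// (le_trans (rnormD _ _))// lerD//.
  apply: (@le_trans _ _ (B * fine (mu (K0 `&` K)))).
    apply: rnorm_bochner_integral => // t [K0t _].
    by rewrite rnormZ -[leRHS]mul1r ler_pM ?rnorm_ge0// fB.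
  rewrite ler_wpM2l//; apply: fine_le.
  - by rewrite ge0_fin_numE//; exact: (relatively_compact_mu haar rI).
  - by rewrite ge0_fin_numE//; exact: (relatively_compact_mu haar rK0).
  - by apply: le_measure; rewrite ?inE//; case: rI.
apply: (bochner_integral_modulated haar rD cf cphi phi1) => L mL LD.
apply: K0P; first exact: relatively_compact_sub LD.
by apply/seteqP; split=> t // -[/LD[_ nK0] /nK0].
Qed.

End UnconditionalIntegral.

(** * Boundedness of star-morphisms of a C*-algebra *)

Section CStar.
Context {R : realType} {A : cstarAlgType R}.
Implicit Types (a b c h k d x y : A).

Lemma rnormM a b : rnorm (a ** b) <= rnorm a * rnorm b.
Proof. by rewrite -lecR rmorphM/= -!normE cmul_norm. Qed.

Lemma rnorm_cstarM a : rnorm (cstar a ** a) = rnorm a ^+ 2.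
Proof. by apply: complexI; rewrite rmorphXn/= -!normE cstar_norm. Qed.

Lemma rnorm_cstar a : rnorm (cstar a) = rnorm a.
Proof.
have le b : rnorm b <= rnorm (cstar b).
  have [b0|b0] := leP (rnorm b) 0; first exact: le_trans b0 (rnorm_ge0 _).
  by rewrite -(ler_pM2r b0) -expr2 -rnorm_cstarM rnormM.
by apply/eqP; rewrite eq_le le andbT -{2}(cstarK a) le.
Qed.

Lemma cstarN a : cstar (- a) = - cstar a.
Proof. by rewrite -scaleN1r cstarZ rmorphN1 scaleN1r. Qed.

Lemma cstarB a b : cstar (a - b) = cstar a - cstar b.
Proof. by rewrite cstarD cstarN. Qed.

Lemma cstarZr (r : R) a : cstar (r%:C *: a) = r%:C *: cstar a.
Proof. by rewrite cstarZ conjc_real. Qed.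

Lemma cmulNr a b : (- a) ** b = - (a ** b).
Proof. by rewrite -scaleN1r cmulZl scaleN1r. Qed.

Lemma cmulrN a b : a ** (- b) = - (a ** b).
Proof. by rewrite -scaleN1r cmulZr scaleN1r. Qed.

Lemma cvg_cmul (T : Type) (F : set_system T) (FF : Filter F) (f g : T -> A) a b :
  f @ F --> a -> g @ F --> b -> (fun t => f t ** g t) @ F --> a ** b.
Proof.
move=> /cvg_rnormP fa /cvg_rnormP gb; apply/cvg_rnormP => e e0.
pose C := 1 + rnorm a + rnorm b.
have C1 : 1 <= C by rewrite /C -addrA lerDl addr_ge0 ?rnorm_ge0.
have C0 : 0 < C by exact: lt_le_trans C1.
have d0 : 0 < Num.min 1 (e / (C + 1)) by rewrite lt_min ltr01 divr_gt0// ltr_wpDl// ltW.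
apply: (filterS _ (filterI (fa _ d0) (gb _ d0))) => t -[].
rewrite !lt_min => /andP[u1 ue] /andP[v1 ve].
set u := f t - a in u1 ue; set v := g t - b in v1 ve.
have -> : f t ** g t - a ** b = u ** g t + a ** v.
  by rewrite /u /v cmulBl cmulBr addrA subrK.
have gE : rnorm (g t) <= 1 + rnorm b.
  by rewrite -(subrK b (g t)) (le_trans (rnormD _ _))// lerD2r ltW.
rewrite (@le_lt_trans _ _ (e / (C + 1) * C))//.
  rewrite (le_trans (rnormD _ _))//.
  rewrite (_ : _ * C = e / (C + 1) * (1 + rnorm b) + rnorm a * (e / (C + 1))).
    rewrite lerD// (le_trans (rnormM _ _))//.
      by rewrite ler_pM ?rnorm_ge0// ltW.
    by rewrite ler_wpM2l ?rnorm_ge0// ltW.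
  by rewrite /C; ring.
rewrite mulrAC ltr_pdivrMr ?ltr_wpDl ?(ltW C0)//.
by rewrite ltr_pM2l// ltrDl.
Qed.

(* [1 - d] is a square root of [1 - h ^ 2], so that [h + i (1 - d)] is unitary;
   [d] is obtained as the fixed point of the contraction [x |-> (h^2 + x^2) / 2]. *)
Lemma exists_unitary_completion h : cstar h = h -> rnorm h <= 2^-1 ->
  exists d, [/\ cstar d = d, d ** h = h ** d & d + d = h ** h + d ** d].
Proof.
move=> hs h2; pose F x := (2^-1 : R)%:C *: (h ** h + x ** x).
pose E := fix E n := if n is m.+1 then F (E m) else 0 : A.
have half0 : 0 <= 2^-1 :> R by [].
have hh : rnorm (h ** h) <= 2^-1 * 2^-1.
  by rewrite (le_trans (rnormM _ _))// ler_pM ?rnorm_ge0.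
have E2 n : rnorm (E n) <= 2^-1.
  elim: n => [|n ih] /=; first by rewrite rnorm0.
  rewrite /F rnormZr ger0_norm//.
  have : rnorm (E n ** E n) <= 2^-1 * 2^-1.
    by rewrite (le_trans (rnormM _ _))// ler_pM ?rnorm_ge0.
  by have := rnormD (h ** h) (E n ** E n); lra.
(* Squaring is 1-Lipschitz on the ball of radius 1/2, so [F] contracts it by 1/2. *)
have FL x y : rnorm x <= 2^-1 -> rnorm y <= 2^-1 ->
    rnorm (F x - F y) <= 2^-1 * rnorm (x - y).
  move=> x2 y2; rewrite -scalerBr rnormZr ger0_norm// ler_wpM2l//.
  rewrite opprD addrACA subrr add0r.
  have -> : x ** x - y ** y = x ** (x - y) + (x - y) ** y.
    by rewrite cmulBl cmulBr addrA subrK.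
  rewrite (le_trans (rnormD _ _))// (_ : rnorm (x - y) =
    2^-1 * rnorm (x - y) + rnorm (x - y) * 2^-1); last by lra.
  by rewrite lerD// (le_trans (rnormM _ _))// ler_pM ?rnorm_ge0.
have EB n m : rnorm (E (n + m)%N - E n) <= 2^-1 ^+ n.
  elim: n => [|n ih]; first by rewrite subr0 expr0 (le_trans (E2 _))//; lra.
  by rewrite addSn /= (le_trans (FL _ _ (E2 _) (E2 _)))// exprS ler_wpM2l.
have [d Ed] : exists d : A, E @ \oo --> d.
  apply: cauchy_rnorm_cvg => e e0.
  have : (fun n => 2^-1 ^+ n : R) @ \oo --> (0 : R).
    by apply: cvg_expr; rewrite gtr0_norm// invf_lt1// ltr1n.
  move=> /cvgrPdist_lt/(_ (e / 2)); rewrite divr_gt0// => /(_ erefl)[N _ NP].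
  exists [set n | (N <= n)%N]; first by exists N.
  have near n : (N <= n)%N -> rnorm (E n - E N) < e / 2.
    move=> Nn; have := EB N (n - N)%N; rewrite subnKC// => /le_lt_trans; apply.
    by have := NP N (leqnn N); rewrite /= sub0r normrN ger0_norm// exprn_ge0.
  move=> m n Nm Nn; rewrite (le_lt_trans (rnorm_distD (E N) _ _))//.
  by rewrite [ltRHS]splitr ltrD ?near// rnorm_distC near.
have uniq (u v : A) (f : nat -> A) : f @ \oo --> u -> f @ \oo --> v -> u = v.
  by move=> fu fv; apply: (cvg_unique (@norm_hausdorff _ A) fu fv).
(* The iterates are real polynomials in [h ** h], hence self-adjoint and commuting with [h]; both
   properties pass to the limit. *)
have Es n : cstar (E n) = E n.
  elim: n => [|n ih] /=; first by rewrite -(scale0r (0 : A)) cstarZ conjc0 !scale0r.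
  by rewrite /F cstarZr cstarD !cstarM hs ih.
have Eh n : E n ** h = h ** E n.
  elim: n => [|n ih] /=; first by rewrite cmul0r cmulr0.
  rewrite /F cmulZl cmulZr cmulDl cmulDr -!cmulA; congr (_ *: (_ + _)).
  by rewrite ih !cmulA ih.
exists d; split.
- apply: (uniq _ _ E) => //; apply/cvg_rnormP => e e0.
  move/cvg_rnormP : Ed => /(_ e e0); apply: filterS => n.
  by rewrite -{2}(Es n) -cstarB rnorm_cstar.
- apply: (uniq _ _ (fun n => E n ** h)).
    by apply: cvg_cmul => //; exact: cvg_cst.
  under eq_fun do rewrite Eh.
  by apply: cvg_cmul => //; exact: cvg_cst.
- have : d = F d.
    apply: (uniq _ _ (fun n => E n.+1)); first by rewrite -(cvg_shiftS E) in Ed.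
    rewrite /F /=; apply: cvgZr; apply: cvgD; first exact: cvg_cst.
    exact: cvg_cmul.
  move=> dE; rewrite {1 2}dE /F -scalerDl -rmorphD/=.
  by rewrite (_ : 2^-1 + 2^-1 = 1 :> R) ?scale1r//; lra.
Qed.

(** By the C*-identity; the hypothesis cancels the two cross terms. *)
Lemma rnorm_add_i x y : cstar x ** y = cstar y ** x ->
  rnorm (x + 'i%C *: y) ^+ 2 = rnorm (cstar x ** x + cstar y ** y).
Proof.
move=> xy; rewrite -rnorm_cstarM; congr rnorm.
rewrite cstarD cstarZ cmulDl !cmulDr !cmulZl !cmulZr xy scalerA.
rewrite (_ : 'i^*%C * 'i%C = 1 :> R[i]); last first.
  by apply/eqP; rewrite eq_complex /=; apply/andP; split; apply/eqP; ring.
rewrite scale1r (_ : 'i^*%C = - 'i%C :> R[i]); last first.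
  by apply/eqP; rewrite eq_complex /= oppr0 !eqxx.
by rewrite scaleNr addrA addrK.
Qed.

Section StarMorphism.
Variable T : {linear A -> A}.
Hypotheses (TM : {morph T : a b / a ** b}) (Ts : {morph T : a / cstar a}).

(** The algebraic relations between [h] and [d] are all that reaches the image, and they suffice: as
    left multiplications, [k] and [1 - e] commute and their squares add up to 1. In the absence of a
    unit, [1 - e] is the map sending [c] to [c - e ** c]. *)
Lemma star_morphism_le1 h : cstar h = h -> rnorm h <= 2^-1 -> rnorm (T h) <= 1.
Proof.
move=> hs h2; have [d [ds dh dE]] := exists_unitary_completion hs h2.
set k := T h; set e := T d.
have ks : cstar k = k by rewrite /k -Ts hs.
have es : cstar e = e by rewrite /e -Ts ds.
have ek : e ** k = k ** e by rewrite /e /k -!TM dh.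
have eE : e + e = k ** k + e ** e by rewrite /e /k -!TM -!linearD dE.
(* [k + i (1 - e)] and [k - i (1 - e)] act isometrically by left
   multiplication and sum to [2 k] *)
have kc c : rnorm (k ** c) <= rnorm c.
  have xy : cstar (k ** c) ** (c - e ** c) = cstar (c - e ** c) ** (k ** c).
    rewrite cstarB !cstarM ks es cmulBl cmulBr; congr (_ - _).
      by rewrite cmulA.
    by rewrite -!cmulA; congr (_ ** _); rewrite !cmulA ek.
  have n1 : cstar (k ** c) ** (k ** c) + cstar (c - e ** c) ** (c - e ** c) =
      cstar c ** c.
    rewrite cstarB !cstarM ks es cmulBl !cmulBr.
    rewrite -!cmulA -!cmulBr -!cmulDr; congr (_ ** _).
    have eec : e ** c + e ** c = k ** (k ** c) + e ** (e ** c).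
      by rewrite -cmulDl eE cmulDl -!cmulA.
    rewrite cmulBr (_ : c - e ** c - _ = c - (e ** c + (e ** c - e ** (e ** c)))).
      by rewrite [e ** c + (_ - _)]addrA eec addrK addrC subrK.
    by rewrite [in RHS]opprD addrA.
  have yN : cstar (k ** c) ** (- (c - e ** c)) = cstar (- (c - e ** c)) ** (k ** c).
    by rewrite cstarN cmulrN cmulNr xy.
  have Up : rnorm (k ** c + 'i%C *: (c - e ** c)) = rnorm c.
    apply/eqP; rewrite -(eqrXn2 (n := 2))// ?rnorm_ge0//.
    by rewrite rnorm_add_i// n1 rnorm_cstarM.
  have Um : rnorm (k ** c + 'i%C *: - (c - e ** c)) = rnorm c.
    apply/eqP; rewrite -(eqrXn2 (n := 2))// ?rnorm_ge0//.
    by rewrite rnorm_add_i// cstarN cmulrN cmulNr opprK n1 rnorm_cstarM.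
  rewrite -(ler_pM2l (@ltr0n R 2)) !mulr_natl !mulr2n -{1}Up -Um.
  apply: le_trans (rnormD _ _); rewrite scalerN addrACA subrr addr0.
  rewrite (_ : k ** c + k ** c = (2%:R)%:C *: (k ** c)); last first.
    by rewrite rmorph_nat scaler_nat mulr2n.
  by rewrite rnormZr normr_nat mulr_natl mulr2n.
have [k0|k0] := leP (rnorm k) 0; first by rewrite (le_trans k0)// ler01.
(* With [c = k], [kc] bounds [rnorm k ^+ 2 = rnorm (k ** k)] by [rnorm k]. *)
by rewrite -(ler_pM2r k0) mul1r -expr2 -rnorm_cstarM ks kc.
Qed.

(** The factor 2 comes from rescaling a self-adjoint element to norm 1/2; a general [a] is reached
    through [cstar a ** a]. The sharp constant is 1, but any bound common to all [alpha t] will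
    do. *)
Lemma star_morphism_bounded a : rnorm (T a) <= 2 * rnorm a.
Proof.
have sa h : cstar h = h -> rnorm (T h) <= 2 * rnorm h.
  move=> hs; have [h0|h0] := leP (rnorm h) 0.
    by rewrite (rnorm_le0 h0) linear0 !rnorm0 mulr0.
  have r0 : 0 < (2 * rnorm h)^-1 by rewrite invr_gt0 mulr_gt0.
  have := star_morphism_le1 (h := (2 * rnorm h)^-1%:C *: h).
  rewrite cstarZr hs linearZ/= !rnormZr gtr0_norm// => /(_ erefl).
  rewrite invfM -mulrA mulVf ?gt_eqF// mulr1 => /(_ (lexx _)).
  by rewrite -invfM mulrC ler_pdivrMr ?mulr_gt0// mul1r.
have [a0|a0] := leP (rnorm (T a)) 0.
  by rewrite (le_trans a0)// mulr_ge0 ?rnorm_ge0.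
rewrite -(ler_pXn2r (n := 2)) ?nnegrE ?mulr_ge0 ?rnorm_ge0//.
rewrite -rnorm_cstarM -Ts -TM (le_trans (sa _ _))//.
  by rewrite cstarM cstarK.
by rewrite rnorm_cstarM exprMn ler_wpM2r ?sqr_ge0// expr2; lra.
Qed.

End StarMorphism.
End CStar.

(** * Characters and neighbourhoods of the trivial one *)

Section Characters.
Context {R : realType} {G : topologicalZmodType}.
Implicit Types (x z : dual R G).

Lemma rnorm_character x t : rnorm (x t : R[i]^o) = 1.
Proof. by rewrite /rnorm character_norm. Qed.

Lemma character0 x : x 0 = 1.
Proof.
by apply: (mulfI (character_neq0 x 0)); rewrite -characterD addr0 mulr1.
Qed.

Lemma characterNK x s : x (- s) * x s = 1.
Proof. by rewrite -characterD addNr character0. Qed.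

(** Mapping the compact set [- S] into the open ball of radius [d] about 1 is a subbasic condition
    of the compact-open topology. *)
Lemma character_near1 (S : set G) (d : R) : compact S -> 0 < d ->
  \forall z \near (1%g : dual R G), forall s, S s ->
    rnorm ((z : dual R G) (- s) - 1 : R[i]^o) <= d.
Proof.
move=> cS d0; pose O := ball (1 : R[i]^o) d%:C.
have cN : compact ((-%R : G -> G) @` S).
  by apply: continuous_compact cS; apply: continuous_subspaceT; exact: opp_continuous.
have oO : open O by exact: ball_open.
have oU := compact_open_open cN oO.
have U1 : [set h : {compact-open, G -> R[i]^o} | h @` (-%R @` S) `<=` O] (dual_fun 1%g).
  by move=> _ [t _ <-]; apply: ballxx; rewrite ltcR.
have near1 : nbhs (1%g : dual R G)
    (dual_fun @^-1` [set h | h @` (-%R @` S) `<=` O]).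
  apply: (@initial_continuous _ _ (@dual_fun R G)).
  exact: open_nbhs_nbhs (conj oU U1).
apply: (@filterS _ (nbhs (1%g : dual R G)) _ _ _ _ near1) => z /= zO s Ss.
have : O (z (- s)) by apply: zO; exists (- s) => //; exists s.
by rewrite /O -ball_normE /= normE ltcR rnorm_distC => /ltW.
Qed.

End Characters.

(** * Integrals of orbits twisted by a character *)

Section Orbits.
Context {R : realType} {G : topologicalZmodType} {A : cstarAlgType R}.
Variables (mu : {measure set (borel G) -> \bar R}) (haar : haar_measure mu).
Variables (alpha : strongly_continuous_action G A).
Implicit Types (x : dual R G) (a b c u : A) (K : set (borel G)).

Lemma rnorm_act t a : rnorm (alpha t a) <= 2 * rnorm a.
Proof.
pose T : {linear A -> A} :=
  HB.pack (alpha t : A -> A) (GRing.isLinear.Build _ _ _ _ _ (act_linear alpha t)).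
exact: (star_morphism_bounded (T := T) (act_mul alpha t) (act_star alpha t)).
Qed.

Lemma bochner_integralZ K (f : G -> A) (k : R[i]) :
  relatively_compact K -> continuous f ->
  bochner_integral mu K (fun t => k *: f t) = k *: bochner_integral mu K f.
Proof.
move=> rK cf; pose T : {linear A -> A} := k \*: idfun.
apply: (bochner_integral_linear haar (T := T) (M := rnorm (k : R[i]^o)) rK cf).
  exact: rnorm_ge0.
by move=> v; rewrite -rnormZ.
Qed.

Section Bilinear.
(* [B u b] is either [u ** b] or [b ** u]. *)
Variable B : A -> A -> A.
Hypotheses (Bl : forall b, linear (B^~ b)) (Br : forall u, linear (B u)).
Hypothesis BM : forall u b, rnorm (B u b) <= rnorm u * rnorm b.

Let Bl_lin b : {linear A -> A} := HB.pack (B^~ b) (GRing.isLinear.Build _ _ _ _ _ (Bl b)).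

Definition twisted x a b (t : G) : A := x t *: B (alpha t a) b.

Lemma twisted_continuous x a b : continuous (twisted x a b).
Proof.
move=> t; apply: cvgZ; first exact: character_continuous.
apply: (@continuous_comp _ _ _ (alpha ^~ a) (Bl_lin b)).
  exact: act_continuous.
by apply: (linear_rnorm_continuous (M := rnorm b)) => u; rewrite mulrC BM.
Qed.

Lemma rnorm_twisted x a b t : rnorm (twisted x a b t) <= 2 * rnorm a * rnorm b.
Proof.
rewrite rnormZ rnorm_character mul1r (le_trans (BM _ _))//.
by rewrite ler_wpM2r ?rnorm_ge0// rnorm_act.
Qed.

Definition twisted_integral K x a b : A := bochner_integral mu K (twisted x a b).

Lemma twisted_integral_linearr K x a : relatively_compact K ->
  linear (twisted_integral K x a).
Proof.
move=> rK k b c; have cb := @twisted_continuous x a b.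
have cc := @twisted_continuous x a c.
rewrite /twisted_integral -(bochner_integralZD haar k rK cb cc).
congr bochner_integral; apply/funext => t.
by rewrite /twisted Br scalerDr !scalerA mulrC.
Qed.

Lemma twisted_integral_linearl K x b : relatively_compact K ->
  linear (fun a => twisted_integral K x a b).
Proof.
move=> rK k a c; have ca := @twisted_continuous x a b.
have cc := @twisted_continuous x c b.
rewrite /twisted_integral -(bochner_integralZD haar k rK ca cc).
congr bochner_integral; apply/funext => t.
by rewrite /twisted (act_linear alpha) Bl scalerDr !scalerA mulrC.
Qed.

Lemma rnorm_twisted_integral K x a b : relatively_compact K ->
  rnorm (twisted_integral K x a b) <= 2 * rnorm a * rnorm b * fine (mu K).
Proof.
move=> rK; apply: rnorm_bochner_integral => //; first exact: twisted_continuous.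
  by rewrite !mulr_ge0 ?rnorm_ge0.
by move=> t _; exact: rnorm_twisted.
Qed.

(** Invariance of [mu] absorbs the translation, and [x t = x (- s) * x (s + t)] leaves the scalar
    [x (- s)]. *)
Lemma twisted_integral_act K x a b s : relatively_compact K ->
  twisted_integral K x (alpha s a) b =
    x (- s) *: twisted_integral (shift_set s K) x a b.
Proof.
move=> rK; have ct := @twisted_continuous x a b.
have cst : continuous (fun t => twisted x a b (s + t)).
  by move=> t; apply: continuous_comp; [exact: shift_continuous|exact: ct].
rewrite /twisted_integral -(bochner_integral_shift haar s rK ct).
rewrite -(bochner_integralZ (x (- s)) rK cst).
congr bochner_integral; apply/funext => t.
rewrite /twisted -actD scalerA characterD mulrA characterNK mul1r.
by rewrite addrC.
Qed.

Section UniformBound.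
Variable a : A.
Hypothesis ia : forall b, uncond_integrable mu (fun t => B (alpha t a) b).

Lemma continuous_orbit b : continuous (fun t => B (alpha t a) b).
Proof.
rewrite (_ : (fun t => _) = twisted 1%g a b); first exact: twisted_continuous.
by apply/funext => t; rewrite /twisted scale1r.
Qed.

(** The uniform boundedness principle is applied to all pairs of [K] and [x] at once, which makes
    [M] independent of both. Each single operator is bounded because [mu K] is finite. *)
Lemma twisted_integral_bound : exists2 M, 0 <= M &
  forall K x b, relatively_compact K ->
    rnorm (twisted_integral K x a b) <= M * rnorm b.
Proof.
pose F := [set f | exists K x, relatively_compact K /\ f = twisted_integral K x a].
have [|b|M M0 FM] := @uniform_boundedness R A A F.
- move=> _ [K [x [rK ->]]]; split; first exact: twisted_integral_linearr.
  exists (2 * rnorm a * fine (mu K)) => b.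
  by rewrite mulrAC; exact: rnorm_twisted_integral.
- have [M fM] := uncond_integrable_bounded haar (@continuous_orbit b) (ia b).
  exists M => _ [K [x [rK ->]]]; apply: (fM x K) => //.
    exact: character_continuous.
  by move=> t; rewrite rnorm_character.
- by exists M => // K x b rK; apply: FM; exists K, x.
Qed.

Lemma twisted_uncond_integrable x b : uncond_integrable mu (twisted x a b).
Proof.
apply: uncond_integrable_modulated (ia b) => //; first exact: continuous_orbit.
  exact: character_continuous.
by move=> t; rewrite rnorm_character.
Qed.

(** The limits are chosen for each [b] separately, and linearity follows from their uniqueness. *)
Lemma twisted_limit : exists2 M, 0 <= M & forall x, exists T : {linear A -> A},
  (forall b, rnorm (T b) <= M * rnorm b) /\
  forall b, is_uncond_integral mu (twisted x a b) (T b).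
Proof.
have [M M0 KM] := twisted_integral_bound.
exists M => // x; have [T TP] := choice (twisted_uncond_integrable x).
have lT : linear T.
  move=> k b c; apply: (uncond_integral_unique (TP _)).
  split; first by case: (TP (k *: b + c)).
  have [_ Tb] := TP b; have [_ Tc] := TP c.
  have : k *: twisted_integral K x a b + twisted_integral K x a c
      @[K --> @relcompact_net G] --> k *: T b + T c.
    by apply: cvgD => //; apply: cvgZr.
  move=> /relcompact_net_rnormP h; apply/relcompact_net_rnormP => e /h[K0 rK0 K0P].
  exists K0 => // K rK K0K; rewrite -/(twisted_integral K x a (k *: b + c)).
  by rewrite (twisted_integral_linearr x a rK k b c) K0P.
exists (HB.pack T (GRing.isLinear.Build _ _ _ _ _ lT) : {linear A -> A}).
split => // b; have [_ Tb] := TP b.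
apply: (cvg_rnorm_le _ Tb).
by exists set0; [exact: relatively_compact0|move=> K [rK _]; exact: KM].
Qed.

End UniformBound.

Section Smoothing.
Hypothesis haus : hausdorff_space G.
Variables (g : G -> R[i]) (S : set (borel G)).
Hypotheses (cg : continuous (g : G -> R[i]^o)) (cS : compact (S : set G)).

Lemma compact_relatively_compact (C : set G) : compact C ->
  relatively_compact (C : set (borel G)).
Proof.
move=> cC; split; first exact: compact_precompact.
by apply: closed_borel; exact: compact_closed.
Qed.

Let rS : relatively_compact S. Proof. exact: compact_relatively_compact. Qed.

Lemma relatively_compact_sub_shifts K : relatively_compact K ->
  exists2 K1, relatively_compact K1 &
    forall s K', S s -> K1 `<=` K' -> K `<=` shift_set s K'.
Proof.
move=> [pK mK]; have cK : compact (closure K) by rewrite -precompactE.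
(* If [t] is in [K] and [s] in [S], then [t - s] lies in [K1], so [t] is in [s + K'] for every [K']
   containing [K1]. Compact in a Hausdorff group, [K1] is closed and hence Borel. *)
pose K1 : set G := (fun p : G * G => p.1 - p.2) @` (closure K `*` S).
exists K1; last first.
  move=> s K' Ss K1K' t Kt; rewrite shift_setE /=; apply: K1K'.
  by exists (t, s) => /=; [split => //; exact: subset_closure|rewrite addrC].
apply: compact_relatively_compact; apply: continuous_compact.
  by apply: continuous_subspaceT; exact: sub_continuous.
exact: compact_setX.
Qed.

Lemma smooth_orbit_continuous a : continuous (fun s => g s *: alpha s a).
Proof. by move=> s; apply: cvgZ; [exact: cg|exact: act_continuous]. Qed.

Lemma smooth_scalar_continuous x : continuous (fun s => g s * x (- s) : R[i]^o).
Proof.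
move=> s; apply: (@cvgM R[i] G (nbhs s) _ (g : G -> R[i]^o) (fun s => x (- s) : R[i]^o)).
  exact: cg.
by apply: (@continuous_comp _ _ _ (-%R : G -> G) (x : G -> R[i]^o));
  [exact: opp_continuous|exact: character_continuous].
Qed.

Lemma smooth_const_continuous x w : continuous (fun s => (g s * x (- s)) *: w : A).
Proof. by move=> s; apply: cvgZl; exact: smooth_scalar_continuous. Qed.

(** The value of [T] at [alpha s a] is [x (- s)] times the integral over [s + K]. Once [K] contains
    [K1], the translates for all [s] in [S] contain [K0], so these integrals are within [d] of [w]
    simultaneously. *)
Lemma twisted_smooth x a b w :
  is_uncond_integral mu (twisted x a b) w ->
  is_uncond_integral mu
    (twisted x (bochner_integral mu S (fun s => g s *: alpha s a)) b)
    (bochner_integral mu S (fun s => (g s * x (- s)) *: w)).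
Proof.
move=> [_ /relcompact_net_rnormP aw]; set a' := bochner_integral _ _ _.
split.
  by move=> K rK; apply: bochner_integrable_continuous => //; exact: twisted_continuous.
apply/relcompact_net_rnormP => e e0.
have [C C0 gC] := relatively_compact_bounded rS cg.
set m := fine (mu S); have m0 : 0 <= m by rewrite fine_ge0.
have Cm0 : 0 <= C * m by rewrite mulr_ge0.
(* Chosen so that [C * d * m < e]; the [+ 1] covers [C * m = 0]. *)
pose d := e / (C * m + 1); have d0 : 0 < d by rewrite divr_gt0// ltr_wpDl.
have [K0 rK0 K0P] := aw _ d0.
have [K1 rK1 K1P] := relatively_compact_sub_shifts rK0.
exists K1 => // K rK K1K.
pose T : {linear A -> A} := HB.pack (fun c => twisted_integral K x c b)
  (GRing.isLinear.Build _ _ _ _ _ (twisted_integral_linearl x b rK)).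
have TM v : rnorm (T v) <= 2 * rnorm b * fine (mu K) * rnorm v.
  rewrite (le_trans (rnorm_twisted_integral _ _ _ rK))//.
  by rewrite le_eqVlt; apply/orP; left; apply/eqP; ring.
have M0 : 0 <= 2 * rnorm b * fine (mu K) by rewrite !mulr_ge0 ?rnorm_ge0 ?fine_ge0.
have co := @smooth_orbit_continuous a.
have cTo : continuous (fun s => T (g s *: alpha s a)).
  move=> s; apply: (@continuous_comp _ _ _ (fun s => g s *: alpha s a) T).
    exact: co.
  exact: linear_rnorm_continuous TM _.
have -> : bochner_integral mu K (twisted x a' b) =
    bochner_integral mu S (fun s => T (g s *: alpha s a)).
  by rewrite (bochner_integral_linear haar rS co M0 TM).
rewrite -[X in rnorm X]addrC -scaleN1r -bochner_integralZD//; last first.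
  exact: smooth_const_continuous.
rewrite (@le_lt_trans _ _ (C * d * m))//.
  apply: rnorm_bochner_integral => //.
  - move=> s; apply: cvgD; last exact: cTo.
    by apply: cvgZr; exact: smooth_const_continuous.
  - by rewrite mulr_ge0// ltW.
  - move=> s Ss; rewrite scaleN1r addrC linearZ /= twisted_integral_act//.
    rewrite scalerA -scalerBr rnormZ ler_pM ?rnorm_ge0//.
      rewrite -[g s * _]/(g s *: (x (- s) : R[i]^o)) rnormZ rnorm_character mulr1.
      exact: gC.
    apply/ltW/K0P; first exact: relatively_compact_shift.
    exact: K1P.
rewrite (_ : C * d * m = e * (C * m / (C * m + 1))).
  by rewrite -[ltRHS]mulr1 ltr_pM2l// ltr_pdivrMr ?ltr_wpDl// mul1r ltrDl.
by rewrite /d; ring.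
Qed.

End Smoothing.
End Bilinear.
End Orbits.

(** * Fourier coefficients and their behaviour under smoothing *)

Section FourierCoefficients.
Context {R : realType} {G : topologicalZmodType} {A : cstarAlgType R}.
Variables (mu : {measure set (borel G) -> \bar R}) (haar : haar_measure mu).
Variables (alpha : strongly_continuous_action G A).
Implicit Types (x y z : dual R G) (a b c u : A).

Lemma cmul_linearl b : linear (fun u : A => u ** b).
Proof. by move=> k u v; rewrite cmulDl cmulZl. Qed.

Lemma cmul_linearr u : linear (fun b : A => u ** b).
Proof. by move=> k b c; rewrite cmulDr cmulZr. Qed.

Lemma rnormM_flip u b : rnorm (b ** u) <= rnorm u * rnorm b.
Proof. by rewrite mulrC rnormM. Qed.

(** The left and right actions are the limits for the two forms of [B]. The bound concerns [lmult],
    from which [mult_norm] is computed. *)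
Lemma fourier_coeff_exists a : act_integrable mu alpha a ->
  exists2 M, 0 <= M & forall x, exists m : multiplier A,
    is_fourier_coeff mu alpha x a m /\ forall b, rnorm (lmult m b) <= M * rnorm b.
Proof.
move=> ia.
have [M M0 lP] := twisted_limit haar cmul_linearl cmul_linearr rnormM
  (fun b => (ia b).1).
have [N N0 rP] := twisted_limit haar (B := fun u b => b ** u) cmul_linearr
  cmul_linearl rnormM_flip (fun b => (ia b).2).
exists M => // x; have [l [lM lU]] := lP x; have [r [rN rU]] := rP x.
(* Both sides are limits of the integral over [K] of [x t *: (b ** alpha t a ** c)], with
   multiplication by [b] or by [c] taken out as a bounded operator. *)
have lr b c : b ** l c = r b ** c.
  pose Lb : {linear A -> A} :=
    HB.pack (fun u : A => b ** u) (GRing.isLinear.Build _ _ _ _ _ (cmul_linearr b)).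
  pose Rc : {linear A -> A} :=
    HB.pack (fun u : A => u ** c) (GRing.isLinear.Build _ _ _ _ _ (cmul_linearl c)).
  have [_ lc] := lU c; have [_ rb] := rU b.
  have h1 : b ** twisted_integral mu alpha cmul K x a c
      @[K --> @relcompact_net G] --> b ** l c.
    by apply: cvg_cmul => //; exact: cvg_cst.
  have h2 : b ** twisted_integral mu alpha cmul K x a c
      @[K --> @relcompact_net G] --> r b ** c.
    have : twisted_integral mu alpha (fun u b => b ** u) K x a b ** c
        @[K --> @relcompact_net G] --> r b ** c.
      by apply: cvg_cmul => //; exact: cvg_cst.
    move=> /relcompact_net_rnormP h; apply/relcompact_net_rnormP => e /h[K0 rK0 K0P].
    exists K0 => // K rK K0K; have := K0P K rK K0K; congr (rnorm (_ - _) < e).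
    have LbM v : rnorm (Lb v) <= rnorm b * rnorm v by exact: rnormM.
    have RcM v : rnorm (Rc v) <= rnorm c * rnorm v by rewrite mulrC; exact: rnormM.
    rewrite -[LHS]/(Rc _) -[RHS]/(Lb _) /twisted_integral.
    rewrite -(bochner_integral_linear haar rK _ (rnorm_ge0 c) RcM); last first.
      exact: (twisted_continuous (B := fun u b => b ** u) cmul_linearr rnormM_flip).
    rewrite -(bochner_integral_linear haar rK _ (rnorm_ge0 b) LbM); last first.
      exact: (twisted_continuous cmul_linearl rnormM).
    congr bochner_integral; apply/funext => t.
    by rewrite /twisted !linearZ /= cmulA.
  exact: (cvg_unique (@norm_hausdorff _ A) h1 h2).
exists (@Multiplier R A l r (linear_rnorm_continuous lM) (linear_rnorm_continuous rN) lr).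
by split => // b; split; [exact: lU|exact: rU].
Qed.

Lemma fourier_coeffP x a : act_integrable mu alpha a ->
  is_fourier_coeff mu alpha x a (fourier_coeff mu alpha x a).
Proof.
move=> /fourier_coeff_exists[M _ /(_ x)[m [mP _]]].
by apply: xgetPex; exists m.
Qed.

(** The chosen coefficient may differ from the multiplier constructed, but uniqueness of the
    unconditional integral makes their left actions agree. *)
Lemma fourier_coeff_bound a : act_integrable mu alpha a ->
  exists2 M, 0 <= M & forall x b,
    rnorm (lmult (fourier_coeff mu alpha x a) b) <= M * rnorm b.
Proof.
move=> ia; have [M M0 mP] := fourier_coeff_exists ia.
exists M => // x b; have [m [mF mM]] := mP x.
rewrite (uncond_integral_unique (fourier_coeffP x ia b).1 (mF b).1).
exact: mM.
Qed.

(** The a priori bound makes the supremum genuine, since [sup] of an unbounded set is 0. *)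
Lemma rnorm_lmult_le (m : multiplier A) (M : R) c :
  (forall b, rnorm (lmult m b) <= M * rnorm b) -> 0 <= M -> `|c| <= 1 ->
  rnorm (lmult m c) <= mult_norm m.
Proof.
move=> mM M0 c1; apply: sup_ubound; last by exists c.
exists M => _ [b /= b1 <-]; rewrite (le_trans (mM b))// ler_piMr//.
by rewrite -lecR -normE.
Qed.

Lemma lmult_sub_mul (m n m' n' : multiplier A) c :
  lmult (mult_sub (mult_mul m n) (mult_mul m' n')) c =
    lmult m (lmult n c) - lmult m' (lmult n' c).
Proof. by []. Qed.

Lemma mult_norm_le (m : multiplier A) (M : R) :
  (forall b, `|b| <= 1 -> rnorm (lmult m b) <= M) -> mult_norm m <= M.
Proof.
move=> mM; apply: ge_sup; last by move=> _ [b /= b1 <-]; exact: mM.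
by exists (rnorm (lmult m 0)), 0 => //=; rewrite normr0.
Qed.

Section Smoothing.
Hypothesis haus : hausdorff_space G.
Variables (g : G -> R[i]) (S : set (borel G)).
Hypotheses (cg : continuous (g : G -> R[i]^o)) (cS : compact (S : set G)).
Variable a : A.
Hypothesis ia : act_integrable mu alpha a.

Let a' := bochner_integral mu S (fun s => g s *: alpha s a).

(** The trivial character in [twisted_smooth], once for each side. *)
Lemma act_integrable_smooth : act_integrable mu alpha a'.
Proof.
move=> b; have [[v vP] [w wP]] := ia b; split.
  have tE c : twisted alpha cmul 1%g c b = (fun t => alpha t c ** b).
    by apply/funext => t; rewrite /twisted scale1r.
  exists (bochner_integral mu S (fun s => (g s * (1%g : dual R G) (- s)) *: v)).
  rewrite -tE; apply: (twisted_smooth haar cmul_linearl rnormM haus cg cS).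
  by rewrite tE.
have tE c : twisted alpha (fun u b => b ** u) 1%g c b = (fun t => b ** alpha t c).
  by apply/funext => t; rewrite /twisted scale1r.
exists (bochner_integral mu S (fun s => (g s * (1%g : dual R G) (- s)) *: w)).
rewrite -tE; apply: (twisted_smooth haar (B := fun u b => b ** u) cmul_linearr
  rnormM_flip haus cg cS).
by rewrite tE.
Qed.

Lemma fourier_coeff_smooth x b : lmult (fourier_coeff mu alpha x a') b =
  bochner_integral mu S
    (fun s => (g s * x (- s)) *: lmult (fourier_coeff mu alpha x a) b).
Proof.
have := (fourier_coeffP x act_integrable_smooth b).1.
move/uncond_integral_unique; apply.
apply: (twisted_smooth haar cmul_linearl rnormM haus cg cS).
exact: (fourier_coeffP x ia b).1.
Qed.

(** [u] and [v] stand for the two products in relative continuity, applied to one vector: [d]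
    controls the change of character, [rnorm (u - v)] the defect for [a]. *)
Lemma rnorm_smooth_dist x z (u v : A) (C d : R) : 0 <= C -> 0 <= d ->
  (forall s, S s -> rnorm (g s : R[i]^o) <= C) ->
  (forall s, S s -> rnorm (z (- s) - 1 : R[i]^o) <= d) ->
  rnorm (bochner_integral mu S (fun s => (g s * (x * z)%g (- s)) *: u) -
    bochner_integral mu S (fun s => (g s * x (- s)) *: v)) <=
  C * (d * rnorm u + rnorm (u - v)) * fine (mu S).
Proof.
move=> C0 d0 gC zd.
have rS : relatively_compact S by exact: compact_relatively_compact.
have cw x' w := @smooth_const_continuous R G A g cg x' w.
rewrite addrC -scaleN1r -bochner_integralZD//.
apply: rnorm_bochner_integral => //.
- by move=> s; apply: cvgD; [apply: cvgZr; exact: cw|exact: cw].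
- by rewrite mulr_ge0// addr_ge0 ?mulr_ge0 ?rnorm_ge0.
- move=> s Ss; rewrite scaleN1r addrC.
  have -> : (g s * (x * z)%g (- s)) *: u - (g s * x (- s)) *: v =
      g s *: (x (- s) *: ((z (- s) - 1) *: u + (u - v))).
    rewrite scalerBl scale1r addrA subrK [x _ *: _]scalerBr !scalerA scalerBr.
    by rewrite !scalerA.
  rewrite !rnormZ rnorm_character mul1r ler_pM ?rnorm_ge0 ?gC//.
  rewrite (le_trans (rnormD _ _))// lerD2r rnormZ ler_pM ?rnorm_ge0//.
  exact: zd.
Qed.

Lemma rel_continuous_smooth b :
  rel_continuous mu alpha a b -> rel_continuous mu alpha a' b.
Proof.
move=> [_ ib ab]; split; [exact: act_integrable_smooth|exact: ib|move=> e e0].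
have rS : relatively_compact S by exact: compact_relatively_compact.
have [C C0 gC] := relatively_compact_bounded rS cg.
have [Ma Ma0 aM] := fourier_coeff_bound ia.
have [Mb Mb0 bM] := fourier_coeff_bound ib.
pose m := fine (mu S); have m0 : 0 <= m by rewrite fine_ge0.
have Cm0 : 0 < C * m + 1 by rewrite ltr_wpDl ?mulr_ge0.
have MM0 : 0 < Ma * Mb + 1 by rewrite ltr_wpDl ?mulr_ge0.
(* Two terms of size [e1], weighted by [g] and integrated over [S], contribute [C * (e1 + e1) * m],
   which is at most [e / 2]. *)
pose e1 := e / (4 * (C * m + 1)).
have e10 : 0 < e1 by rewrite divr_gt0// mulr_gt0.
(* Makes [d * rnorm u] at most [e1], as [rnorm u] will be at most [Ma * Mb]. *)
pose d := e1 / (Ma * Mb + 1); have d0 : 0 < d by rewrite divr_gt0.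
have dM : d * (Ma * Mb) <= e1.
  by rewrite /d mulrAC ler_pdivrMr// ler_pM2l// lerDl.
have near1 := @filterI _ (nbhs (1%g : dual R G)) (nbhs_filter _) _ _ (ab e1 e10)
  (character_near1 cS d0).
apply: (@filterS _ (nbhs (1%g : dual R G)) _ _ _ _ near1) => z [zab zd] x y.
(* A supremum preserves only weak inequalities; aiming at [e / 2] keeps the final one strict. *)
apply: (@le_lt_trans _ _ (e / 2)); last by lra.
apply: mult_norm_le => c c1.
have c1' : rnorm c <= 1 by rewrite -lecR -normE.
have EM x' y' c' : rnorm (lmult (fourier_coeff mu alpha x' a)
    (lmult (fourier_coeff mu alpha y' b) c')) <= Ma * Mb * rnorm c'.
  by rewrite (le_trans (aM _ _))// -mulrA ler_wpM2l// bM.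
pose u := lmult (fourier_coeff mu alpha (x * z)%g a)
  (lmult (fourier_coeff mu alpha y b) c).
pose v := lmult (fourier_coeff mu alpha x a)
  (lmult (fourier_coeff mu alpha (z * y)%g b) c).
have uv : rnorm (u - v) <= e1.
  apply: le_trans (ltW (zab x y)).
  apply: (@rnorm_lmult_le (mult_sub (mult_mul (fourier_coeff mu alpha (x * z)%g a)
    (fourier_coeff mu alpha y b)) (mult_mul (fourier_coeff mu alpha x a)
    (fourier_coeff mu alpha (z * y)%g b))) (Ma * Mb + Ma * Mb)) => //.
    move=> c'; rewrite mulrDl; apply: le_trans (lerD (EM _ _ _) (EM _ _ _)).
    exact: rnormB.
  by rewrite addr_ge0// mulr_ge0.
have uM : rnorm u <= Ma * Mb.
  by rewrite (le_trans (EM _ _ _))// ler_piMr// mulr_ge0.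
have fu := fourier_coeff_smooth (x * z)%g (lmult (fourier_coeff mu alpha y b) c).
have fv := fourier_coeff_smooth x (lmult (fourier_coeff mu alpha (z * y)%g b) c).
have -> : lmult (mult_sub (mult_mul (fourier_coeff mu alpha (x * z)%g a')
    (fourier_coeff mu alpha y b)) (mult_mul (fourier_coeff mu alpha x a')
    (fourier_coeff mu alpha (z * y)%g b))) c =
    bochner_integral mu S (fun s => (g s * (x * z)%g (- s)) *: u) -
    bochner_integral mu S (fun s => (g s * x (- s)) *: v).
  by rewrite lmult_sub_mul; congr (_ - _); [exact: fu|exact: fv].
rewrite (le_trans (rnorm_smooth_dist _ _ _ C0 (ltW d0) gC zd))//.
apply: (@le_trans _ _ (C * (e1 + e1) * m)).
  rewrite ler_wpM2r// ler_wpM2l// lerD//.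
  by rewrite (le_trans _ dM)// ler_wpM2l// ltW.
rewrite (_ : C * (e1 + e1) * m = e / 2 * (C * m / (C * m + 1))).
  by rewrite ler_piMr ?divr_ge0 ?(ltW e0)// ler_pdivrMr// mul1r lerDl.
by rewrite /e1; field; rewrite gt_eqF.
Qed.

End Smoothing.
End FourierCoefficients.

Theorem proposition8p5 (R : realType) (G : topologicalZmodType)
    (A : cstarAlgType R) (mu : {measure set (borel G) -> \bar R})
    (alpha : strongly_continuous_action G A) (a b : A) :
  hausdorff_space G -> locally_compact [set: G] -> haar_measure mu ->
  act_integrable mu alpha a -> act_integrable mu alpha b ->
  rel_continuous mu alpha a b ->
  forall g : G -> R[i], cont_compact_support g ->
  rel_continuous mu alpha
    (bochner_integral mu [set: G] (fun t => g t *: alpha t a)) b.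
Proof.
move=> haus _ haar ia _ ab g [cg cS].
pose S : set (borel G) := closure [set t | g t != 0].
have rS : relatively_compact S by exact: compact_relatively_compact.
(* [G] may have infinite measure, but the integrand vanishes off the closed support of [g]. *)
have -> : bochner_integral mu [set: G] (fun t => g t *: alpha t a) =
    bochner_integral mu S (fun t => g t *: alpha t a).
  apply: (bochner_integral_support haar) => //.
    exact: smooth_orbit_continuous.
  move=> t _ St; have [->|gt0] := eqVneq (g t) 0; first by rewrite scale0r.
  by exfalso; apply: St; exact: subset_closure.
exact: rel_continuous_smooth.
Qed.
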